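(* Let $T$ be a pattern-tree of constant total size $\Sigma(T)$ and let $\pi\in\mathbb{S}_n$. Then $\#T(\pi)$ (the evaluation of the vector of $T$ over $\pi$) can be computed in $\widetilde{\mathcal{O}}(n^{s(T)})$ time, where $s(T)=\max_{v\in V(T)} s(v)$ is the maximum size of $T$.
   Context: The points of $\pi$ are $p(\pi)=\{(i,\pi(i)):i\in[n]\}$; $\pi$ is given as the vector $(\pi(1),\dots,\pi(n))$, and $\widetilde{\mathcal{O}}$ hides polylogarithmic factors in $n$. A pattern-tree $T$ is a rooted tree (edges oriented away from the root) where each vertex $v$ is labeled by a permutation $\tau_v\in\mathbb{S}_r$ ($r=s(v)\ge1$, the size of $v$) and is assigned fresh variables $x_v^1,\dots,x_v^r,y_v^1,\dots,y_v^r$, with points $p_v^i=(x_v^i,y_v^i)$ and $p_v=\{p_v^1,\dots,p_v^r\}$; each edge $u\to v$ is labeled by two strict posets $\mathcal{P}^x_{uv}$ on $\{x_u^i\}\sqcup\{x_v^j\}$ and $\mathcal{P}^y_{uv}$ on $\{y_u^i\}\sqcup\{y_v^j\}$, and a set $E_{uv}\subseteq p_u\times p_v$ of equalities. Let $p(T)=\bigsqcup_v p_v$ and $\Sigma(T)=\sum_v s(v)$. The constraints of $T$ are: for every vertex $v$, $x_v^1<\dots<x_v^r$ and $y_v^i<y_v^j$ whenever $\tau_v(i)<\tau_v(j)$; for every edge, the inequalities of $\mathcal{P}^x_{uv},\mathcal{P}^y_{uv}$ and the point equalities in $E_{uv}$. An occurrence of $T$ in $\pi$ is a map $\varphi:p(T)\to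 p(\pi)$ (not necessarily injective) such that assigning to each point variable the coordinates of its image satisfies all constraints; $\#T(\pi)$ is the number of occurrences. *)

(* Defs.v *)
From mathcomp Require Import all_boot all_fingroup.

Set Implicit Arguments.
Unset Strict Implicit.
Unset Printing Implicit Defensive.

Definition strict_poset (A : Type) (r : rel A) : Prop :=
  irreflexive r /\ transitive r.

(* Indices are 0-based: the point p_v^(i+1) is [Tagged _ i] with
   [i : 'I_(vsize v)].  In the posets labelling an edge u -> v, [inl i] stands
   for the i-th variable of u and [inr j] for the j-th variable of v.  Edge
   labels of pairs (u, v) that are not edges carry no meaning. *)
Record pattern_tree := PatternTree {
  vertex : finType;
  root : vertex;
  edge : rel vertex;
  edge_root : forall u, ~~ edge u root;
  edge_parent : forall u u' v, edge u v -> edge u' v -> u = u';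
  edge_connect : forall v, connect edge root v;
  vsize : vertex -> nat;
  vsize_gt0 : forall v, 0 < vsize v;
  vlabel : forall v, 'S_(vsize v);
  xposet : forall u v, rel ('I_(vsize u) + 'I_(vsize v));
  yposet : forall u v, rel ('I_(vsize u) + 'I_(vsize v));
  xposetP : forall u v, edge u v -> strict_poset (@xposet u v);
  yposetP : forall u v, edge u v -> strict_poset (@yposet u v);
  eqpoints : forall u v, {set 'I_(vsize u) * 'I_(vsize v)}
}.

Arguments edge : clear implicits.
Arguments xposet : clear implicits.
Arguments yposet : clear implicits.
Arguments eqpoints : clear implicits.

Definition max_size (T : pattern_tree) : nat := \max_(v : vertex T) vsize v.

Definition tree_point (T : pattern_tree) : finType :=
  {v : vertex T & 'I_(vsize v)}.

Definition vpoint (T : pattern_tree) (v : vertex T) (i : 'I_(vsize v)) :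
  tree_point T := Tagged (fun v => 'I_(vsize v)) i.

Definition epoint (T : pattern_tree) (u v : vertex T)
    (z : 'I_(vsize u) + 'I_(vsize v)) : tree_point T :=
  match z with inl i => vpoint i | inr j => vpoint j end.

Definition perm_points (n : nat) (pi : 'S_n) : {set 'I_n * 'I_n} :=
  [set (i, pi i) | i : 'I_n].

Section Occurrences.
Variables (T : pattern_tree) (n : nat).
Implicit Type phi : {ffun tree_point T -> 'I_n * 'I_n}.

Definition vertex_constraints phi (v : vertex T) : bool :=
  [forall i : 'I_(vsize v), forall j : 'I_(vsize v),
    ((i < j) ==> ((phi (vpoint i)).1 < (phi (vpoint j)).1)) &&
    ((vlabel v i < vlabel v j) ==>
       ((phi (vpoint i)).2 < (phi (vpoint j)).2))].

Definition poset_constraints phi (u v : vertex T) : bool :=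
  [forall z, forall z',
    (xposet T u v z z' ==> ((phi (epoint z)).1 < (phi (epoint z')).1)) &&
    (yposet T u v z z' ==> ((phi (epoint z)).2 < (phi (epoint z')).2))].

Definition eq_constraints phi (u v : vertex T) : bool :=
  [forall i, forall j,
    ((i, j) \in eqpoints T u v) ==> (phi (vpoint i) == phi (vpoint j))].

Definition occurrence (pi : 'S_n) phi : bool :=
  [&& [forall p, phi p \in perm_points pi],
      [forall v, vertex_constraints phi v] &
      [forall u, forall v, edge T u v ==>
         (poset_constraints phi u v && eq_constraints phi u v)]].

Definition count_occ (pi : 'S_n) : nat := #|[set phi | occurrence pi phi]|.

End Occurrences.

(* A program uses finitely many registers and an infinite memory of natural
   numbers.  Every instruction is charged the total bit length of the operands
   and addresses it handles.  Compared with a unit-cost machine on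
   O(log n)-bit words this changes polynomial running times only by a factor
   O(log n). *)

Definition reg := nat.

Variant arith := Add | Sub | Mul | Div.

Variant instr :=
| Const of reg & nat            (* r := k *)
| Op of arith & reg & reg & reg (* r := a op b *)
| Read of reg & reg             (* r := mem[a] *)
| Write of reg & reg.           (* mem[a] := b *)

Inductive program :=
| Instr of instr
| Seq of program & program
| IfLt of reg & reg & program & program
| WhileLt of reg & reg & program.

Record state := State { regs : reg -> nat; mem : nat -> nat }.

Definition arith_eval (o : arith) : nat -> nat -> nat :=
  match o with Add => addn | Sub => subn | Mul => muln | Div => divn end.

Definition upd (f : nat -> nat) (a k : nat) : nat -> nat :=
  fun b => if b == a then k else f b.

Definition set_reg (s : state) (r k : nat) : state :=
  State (upd (regs s) r k) (mem s).

Definition instr_eval (c : instr) (s : state) : state :=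
  match c with
  | Const r k => set_reg s r k
  | Op o r a b => set_reg s r (arith_eval o (regs s a) (regs s b))
  | Read r a => set_reg s r (mem s (regs s a))
  | Write a b => State (regs s) (upd (mem s) (regs s a) (regs s b))
  end.

(* [trunc_log 2 0 = 0], so 0 has bit length 1. *)
Definition bitlen (k : nat) : nat := (trunc_log 2 k).+1.

Definition instr_cost (c : instr) (s : state) : nat :=
  match c with
  | Const _ k => bitlen k
  | Op _ _ a b => bitlen (regs s a) + bitlen (regs s b)
  | Read _ a => bitlen (regs s a) + bitlen (mem s (regs s a))
  | Write a b => bitlen (regs s a) + bitlen (regs s b)
  end.

Definition test_lt (s : state) (a b : reg) : bool := regs s a < regs s b.

Definition test_cost (s : state) (a b : reg) : nat :=
  bitlen (regs s a) + bitlen (regs s b).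

(* [exec P s s' t]: started in s, P halts in s' after time t. *)
Inductive exec : program -> state -> state -> nat -> Prop :=
| ExecInstr c s : exec (Instr c) s (instr_eval c s) (instr_cost c s)
| ExecSeq P Q s1 s2 s3 t1 t2 :
    exec P s1 s2 t1 -> exec Q s2 s3 t2 -> exec (Seq P Q) s1 s3 (t1 + t2)
| ExecIf a b P Q s s' t :
    exec (if test_lt s a b then P else Q) s s' t ->
    exec (IfLt a b P Q) s s' (test_cost s a b + t)
| ExecWhileStop a b P s :
    ~~ test_lt s a b -> exec (WhileLt a b P) s s (test_cost s a b)
| ExecWhileLoop a b P s1 s2 s3 t1 t2 :
    test_lt s1 a b -> exec P s1 s2 t1 -> exec (WhileLt a b P) s2 s3 t2 ->
    exec (WhileLt a b P) s1 s3 (test_cost s1 a b + t1 + t2).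

Lemma exec_det P s s1 s2 t1 t2 :
  exec P s s1 t1 -> exec P s s2 t2 -> s1 = s2 /\ t1 = t2.
Proof.
move=> H; elim: H s2 t2 => {P s s1 t1}.
- by move=> c s s2 t2 H; inversion H.
- move=> P Q s1 s2 s3 t1 t2 _ IH1 _ IH2 s t H; inversion H; subst.
  match goal with [H : exec P _ _ _ |- _] => case: (IH1 _ _ H) => ? ? end.
  subst; match goal with [H : exec Q _ _ _ |- _] => case: (IH2 _ _ H) => ? ? end.
  by subst.
- move=> a b P Q s s' t _ IH s2 t2 H; inversion H; subst.
  by match goal with [H : exec _ _ _ _ |- _] => case: (IH _ _ H) => -> -> end.
- by move=> a b P s Hs s2 t2 H; inversion H; subst => //; case/negP: Hs.
- move=> a b P s1 s2 s3 t1 t2 Hs _ IH1 _ IH2 s t H; inversion H; clear H; subst.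
    by match goal with [H : is_true (~~ _) |- _] => case/negP: H end.
  match goal with [H : exec P _ _ _ |- _] => case: (IH1 _ _ H) => ? ? end.
  subst.
  match goal with [H : exec (WhileLt _ _ _) _ _ _ |- _] =>
    case: (IH2 _ _ H) => ? ? end.
  by subst.
Qed.

(* The input: n in register 0, the value pi(i) in memory cell i for i < n, and
   0 everywhere else. *)
Definition perm_input (n : nat) (pi : 'S_n) : state :=
  State (upd (fun=> 0) 0 n)
        (fun a => if insub a is Some i then nat_of_ord (pi i) else 0).

(* The output is read in register 0. *)
Definition outputs_within (P : program) (s : state) (k t : nat) : Prop :=
  exists (s' : state) (t' : nat), [/\ exec P s s' t', regs s' 0 = k & t' <= t].

Definition softO (f g : nat -> nat) : Prop :=
  exists C k n0 : nat,
    forall n, n0 <= n -> f n <= C * (g n * trunc_log 2 n ^ k).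

(* One program for all inputs; [t n] bounds its time on permutations of size
   n. *)
Definition computable_in_softO
    (F : forall n : nat, 'S_n -> nat) (g : nat -> nat) : Prop :=
  exists (P : program) (t : nat -> nat),
    (forall (n : nat) (pi : 'S_n),
        outputs_within P (perm_input pi) (F n pi) (t n)) /\
    softO t g.

(* Main.v *)
(** A tuple of points for a vertex [v] is coded by the number [t < n ^ s(v)]
    whose base-[n] digits are the abscissas.  Going up the tree, the weight of
    [t] at [v] (the number of occurrences of the subtree at [v] with root tuple
    [t]) is an indicator times the product, over the children [c] of [v], of the
    sums of the weights of the tuples [t'] of [c] compatible with [t].

    These sums cost polylogarithmic time each because the indicator of [a < b]
    is the sum, over [O(log n)] levels [l], of an equality between a key that
    depends on [(l, a)] only and a key that depends on [(l, b)] only.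
    Compatibility of [t] and [t'] is a conjunction of [K] such comparisons, so
    its indicator is a sum over [O(log n) ^ K] level vectors of equalities
    between a key vector of [t] and one of [t'].  The program therefore adds the
    weight of [t'] to the memory cell addressed by each of its key vectors, and
    the sum for [t] reads one cell per level vector.  All numbers that occur are
    polynomial in [n], hence every instruction costs [O(log n)]. *)


From mathcomp Require Import all_boot all_fingroup.
From mathcomp Require Import zify.
Require Import Defs.

Set Implicit Arguments.
Unset Strict Implicit.
Unset Printing Implicit Defensive.

(** * Straight-line expressions and timed runs *)

Lemma bitlen_le (a b : nat) : a <= b -> bitlen a <= bitlen b.
Proof. by move=> ab; rewrite /bitlen ltnS leq_trunc_log. Qed.

Lemma bitlen_exp (x k : nat) : 0 < x -> 0 < k -> bitlen (x ^ k) <= k * bitlen x.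
Proof.
move=> x0 k0; rewrite /bitlen.
have xk0 : 0 < x ^ k by rewrite expn_gt0 x0.
rewrite -(@ltn_exp2l 2) //.
apply: (@leq_ltn_trans (x ^ k)); first exact: trunc_logP.
by rewrite mulnC expnM ltn_exp2r // trunc_log_ltn.
Qed.

(* [n], the number of levels, the current tuple and the number of tuples, the
   current level vector and the number of level vectors, the sum read from the
   table, the weight of the current tuple. *)
Variant var := Vn | VL | Vt | VN | Vlam | Vbd | Vacc | Vw.

Definition var_reg (x : var) : reg :=
  match x with
  | Vn => 0 | VL => 1 | Vt => 2 | VN => 3
  | Vlam => 4 | Vbd => 5 | Vacc => 6 | Vw => 7
  end.

Lemma var_reg_lt (x : var) : var_reg x < 8. Proof. by case: x. Qed.

Inductive expr :=
| EVar of var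
| ECst of nat
| EOp of arith & expr & expr
| EMem of expr.

Fixpoint ev (v : seq nat) (m : nat -> nat) (e : expr) : nat :=
  match e with
  | EVar x => nth 0 v (var_reg x)
  | ECst k => k
  | EOp o a b => arith_eval o (ev v m a) (ev v m b)
  | EMem a => m (ev v m a)
  end.

(* Registers 0 to 7 hold the variables; registers from [d >= 8] on are an
   evaluation stack. *)
Fixpoint compile (e : expr) (d : reg) : program :=
  match e with
  | EVar x => Seq (Instr (Const d 0)) (Instr (Op Add d (var_reg x) d))
  | ECst k => Instr (Const d k)
  | EOp o a b => Seq (compile a d) (Seq (compile b d.+1) (Instr (Op o d d d.+1)))
  | EMem a => Seq (compile a d) (Instr (Read d d))
  end.

(** If all registers and cells are at most [X], with [X >= 2], the value of [e] is at most
    [X ^ edeg e]. A constant gets [k.+1] so that the degree is positive even for 0. *)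
Fixpoint edeg (e : expr) : nat :=
  match e with
  | EVar _ => 1
  | ECst k => k.+1
  | EOp _ a b => edeg a + edeg b
  | EMem a => edeg a
  end.

(** Time of the compiled code in units of [bitlen X]. Loading a variable costs 3: there is no copy
    instruction, so a zero is written and the variable is added to it. *)
Fixpoint ecost (e : expr) : nat :=
  match e with
  | EVar _ => 3
  | ECst k => bitlen k
  | EOp _ a b => ecost a + ecost b + edeg a + edeg b
  | EMem a => ecost a + edeg a + 1
  end.

Definition assign (x : var) (e : expr) : program :=
  Seq (compile e 8)
      (Seq (Instr (Const (var_reg x) 0)) (Instr (Op Add (var_reg x) (var_reg x) 8))).

Definition store (a e : expr) : program :=
  Seq (compile a 8) (Seq (compile e 9) (Instr (Write 8 9))).

Definition while (x y : var) (c : program) : program :=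
  WhileLt (var_reg x) (var_reg y) c.

Definition skip : program := Instr (Const 8 0).

Definition seqs (cs : seq program) : program := foldr Seq skip cs.

Definition bounded (X : nat) (v : seq nat) (m : nat -> nat) : Prop :=
  all (fun k => k <= X) v /\ forall a, m a <= X.

(** The evaluation stack is left unspecified, so scratch values need no tracking; memories are
    compared pointwise, which avoids functional extensionality. *)
Definition vis (v : seq nat) (m : nat -> nat) (s : state) : Prop :=
  (forall r, r < 8 -> regs s r = nth 0 v r) /\ mem s =1 m.

(** Here [t] acts as a unit-cost time, each unit standing for [bitlen X]. *)
Definition runs (X : nat) (v : seq nat) (m : nat -> nat) (c : program) (t : nat)
    (v' : seq nat) (m' : nat -> nat) : Prop :=
  forall s, vis v m s ->
  exists s' t', [/\ exec c s s' t', t' <= t * bitlen X & vis v' m' s'].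

Lemma edeg_gt0 (e : expr) : 0 < edeg e.
Proof. by elim: e => //= o a Ha b Hb; rewrite addn_gt0 Ha. Qed.

Section Runs.
Variable X : nat.
Hypothesis X_gt1 : 1 < X.

Let X_gt0 : 0 < X. Proof. exact: ltnW. Qed.

Lemma bitlen_gt0 (k : nat) : 0 < bitlen k. Proof. by []. Qed.

Lemma bounded_nth (v : seq nat) (m : nat -> nat) (r : nat) :
  bounded X v m -> nth 0 v r <= X.
Proof.
case=> /allP Hv _; case: (ltnP r (size v)) => Hr; first by apply/Hv/mem_nth.
by rewrite nth_default.
Qed.

Lemma ev_bound (v : seq nat) (m : nat -> nat) (e : expr) :
  bounded X v m -> ev v m e <= X ^ edeg e.
Proof.
move=> Hb; elim: e => [x|k|o a Ha b Hb'|a Ha] /=.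
- by rewrite expn1; apply: bounded_nth Hb.
- by apply: leq_trans (ltnW (ltn_expl k X_gt1)) _; rewrite leq_pexp2l.
- have H1 : 1 < X ^ edeg a by rewrite -(expn0 X) ltn_exp2l // edeg_gt0.
  have H2 : 1 < X ^ edeg b by rewrite -(expn0 X) ltn_exp2l // edeg_gt0.
  rewrite expnD; case: o => /=.
  + apply: leq_trans (leq_add Ha Hb') _.
    (* Two numbers that are at least 2 have a sum bounded by their product. *)
    by move: H1 H2; generalize (X ^ edeg a) (X ^ edeg b) => p q; nia.
  + apply: leq_trans (leq_subr _ _) _; apply: leq_trans Ha _.
    by rewrite leq_pmulr // ltnW.
  + exact: leq_mul.
  + apply: leq_trans (leq_div _ _) _; apply: leq_trans Ha _.
    by rewrite leq_pmulr // ltnW.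
- apply: leq_trans (proj2 Hb _) _.
  by rewrite -{1}(expn1 X) leq_pexp2l // edeg_gt0.
Qed.

Lemma bitlen_ev (v : seq nat) (m : nat -> nat) (e : expr) :
  bounded X v m -> bitlen (ev v m e) <= edeg e * bitlen X.
Proof.
move=> Hb; apply: leq_trans (bitlen_le (ev_bound e Hb)) _.
by apply: bitlen_exp => //; apply: edeg_gt0.
Qed.

(** Registers below [d] survive, so a left operand kept in register [d] stays intact while the right
    one is evaluated from [d.+1] on. *)
Lemma compile_exec (v : seq nat) (m : nat -> nat) (e : expr) (d : reg)
    (s : state) :
  bounded X v m -> vis v m s -> 7 < d ->
  exists s' t, [/\ exec (compile e d) s s' t, t <= ecost e * bitlen X,
    regs s' d = ev v m e, (forall r, r < d -> regs s' r = regs s r) &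
    mem s' = mem s].
Proof.
move=> Hb; elim: e d s => [x|k|o a Ha b Hb'|a Ha] d s Hs Hd /=.
- have Hx : (var_reg x == d) = false.
    by apply/eqP; have := var_reg_lt x; lia.
  eexists _, _; split; first by apply: ExecSeq; apply: ExecInstr.
  + rewrite /= /upd /= Hx eqxx (proj1 Hs) ?var_reg_lt //.
    have := bitlen_le (bounded_nth (var_reg x) Hb).
    have := bitlen_gt0 X; rewrite /bitlen (_ : trunc_log 2 0 = 0) //.
    by lia.
  + by rewrite /= /upd /= eqxx Hx addn0 (proj1 Hs) ?var_reg_lt.
  + by move=> r Hr; rewrite /= /upd; case: eqP => // ?; lia.
  + by [].
- eexists _, _; split; first exact: ExecInstr.
  + by rewrite /= leq_pmulr.
  + by rewrite /= /upd eqxx.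
  + by move=> r Hr; rewrite /= /upd; case: eqP => // ?; lia.
  + by [].
- have [s1 [t1 [E1 T1 R1 F1 M1]]] := Ha d s Hs Hd.
  have Hs1 : vis v m s1.
    split=> [r Hr|x]; last by rewrite M1 (proj2 Hs).
    by rewrite F1 ?(proj1 Hs) //; lia.
  have [s2 [t2 [E2 T2 R2 F2 M2]]] := Hb' d.+1 s1 Hs1 (ltnW Hd).
  eexists _, _; split.
  + by apply: (ExecSeq E1); apply: (ExecSeq E2); apply: ExecInstr.
  + rewrite /= R2 F2 // R1 !mulnDl -!addnA leq_add //.
    by rewrite leq_add // leq_add // bitlen_ev.
  + by rewrite /= /upd eqxx R2 F2 // R1.
  + move=> r Hr; rewrite /= /upd; case: eqP => [?|_]; first lia.
    by rewrite F2 ?F1 //; lia.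
  + by rewrite /= M2.
- have [s1 [t1 [E1 T1 R1 F1 M1]]] := Ha d s Hs Hd.
  eexists _, _; split.
  + by apply: (ExecSeq E1); apply: ExecInstr.
  + rewrite /= R1 M1 (proj2 Hs) !mulnDl -!addnA leq_add // leq_add ?bitlen_ev //.
    by rewrite mul1n bitlen_le // (proj2 Hb).
  + by rewrite /= /upd eqxx R1 M1 (proj2 Hs).
  + move=> r Hr; rewrite /= /upd; case: eqP => [?|_]; first lia.
    by rewrite F1.
  + by rewrite /= M1.
Qed.

Lemma nth_set_nth_if (v : seq nat) (i j k : nat) :
  nth 0 (set_nth 0 v i k) j = if j == i then k else nth 0 v j.
Proof. by rewrite nth_set_nth. Qed.

Lemma runs_assign (v : seq nat) (m : nat -> nat) (x : var) (e : expr) :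
  bounded X v m ->
  runs X v m (assign x e) (ecost e + edeg e + 2)
    (set_nth 0 v (var_reg x) (ev v m e)) m.
Proof.
move=> Hb s Hs; have [s1 [t1 [E1 T1 R1 F1 M1]]] := compile_exec e Hb Hs (leqnn 8).
have Hx : (8 == var_reg x) = false by case: (x).
eexists _, _; split.
- by apply: (ExecSeq E1); apply: ExecSeq; apply: ExecInstr.
- rewrite /= /upd /= eqxx Hx R1 !mulnDl -addnA leq_add //.
  rewrite /bitlen (_ : trunc_log 2 0 = 0) // -/(bitlen (ev v m e)) -/(bitlen X).
  by have := bitlen_ev e Hb; have := bitlen_gt0 X; lia.
- split=> [r Hr|a] /=; last by rewrite M1 (proj2 Hs).
  rewrite nth_set_nth_if /upd /= eqxx Hx R1 add0n; case: eqP => //= _.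
  by rewrite F1 ?(proj1 Hs).
Qed.

Lemma runs_store (v : seq nat) (m : nat -> nat) (a e : expr) :
  bounded X v m ->
  runs X v m (store a e) (ecost a + ecost e + edeg a + edeg e)
    v (upd m (ev v m a) (ev v m e)).
Proof.
move=> Hb s Hs; have [s1 [t1 [E1 T1 R1 F1 M1]]] := compile_exec a Hb Hs (leqnn 8).
have Hs1 : vis v m s1.
  by split=> [r Hr|b]; rewrite ?M1 ?(proj2 Hs) ?F1 ?(proj1 Hs).
have [s2 [t2 [E2 T2 R2 F2 M2]]] := compile_exec e Hb Hs1 (leqnSn 8).
eexists _, _; split.
- by apply: (ExecSeq E1); apply: (ExecSeq E2); apply: ExecInstr.
- rewrite /= R2 F2 // R1 !mulnDl -!addnA leq_add // leq_add // leq_add //.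
    exact: bitlen_ev.
  exact: bitlen_ev.
- split=> [r Hr|b] /=; first by rewrite F2 ?(proj1 Hs1) // ltnW.
  by rewrite R2 F2 // R1 /upd M2 (proj2 Hs1).
Qed.

Lemma runs_skip (v : seq nat) (m : nat -> nat) : runs X v m skip 1 v m.
Proof.
move=> s Hs; eexists _, _; split; first exact: ExecInstr.
  by rewrite /= mul1n bitlen_gt0.
split=> [r Hr|b] /=; last exact: (proj2 Hs).
by rewrite /upd; case: eqP Hr => [->|_ Hr] //; rewrite (proj1 Hs).
Qed.

Lemma runs_seq (v v1 v2 : seq nat) (m m1 m2 : nat -> nat) (c c' : program)
    (t t' : nat) :
  runs X v m c t v1 m1 -> runs X v1 m1 c' t' v2 m2 ->
  runs X v m (Seq c c') (t + t') v2 m2.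
Proof.
move=> H1 H2 s Hs; have [s1 [t1 [E1 T1 V1]]] := H1 s Hs.
have [s2 [t2 [E2 T2 V2]]] := H2 s1 V1.
by exists s2, (t1 + t2); split=> //; [apply: ExecSeq E1 E2 | rewrite mulnDl leq_add].
Qed.

Lemma runs_weaken (v v' w w' : seq nat) (m m' p p' : nat -> nat) (c : program)
    (t u : nat) :
  runs X v m c t v' m' -> w = v -> p =1 m -> w' = v' -> p' =1 m' -> t <= u ->
  runs X w p c u w' p'.
Proof.
move=> H -> Hp -> Hp' tu s [Hs Hm].
have [|s1 [t1 [E1 T1 [V1 W1]]]] := H s; first by split=> // a; rewrite Hm.
exists s1, t1; split=> //; last by split=> // a; rewrite W1 Hp'.
by apply: leq_trans T1 _; rewrite leq_mul2r tu orbT.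
Qed.

(** [vf] and [mf] describe the state after each round. A test costs at most 2 units, hence [t + 2]
    per round and a final 2. *)
Lemma runs_while (N t : nat) (vf : nat -> seq nat) (mf : nat -> nat -> nat)
    (x y : var) (c : program) :
  (forall i, i <= N -> bounded X (vf i) (mf i)) ->
  (forall i, i <= N ->
     (nth 0 (vf i) (var_reg x) < nth 0 (vf i) (var_reg y)) = (i < N)) ->
  (forall i, i < N -> runs X (vf i) (mf i) c t (vf i.+1) (mf i.+1)) ->
  runs X (vf 0) (mf 0) (while x y c) (N * (t + 2) + 2) (vf N) (mf N).
Proof.
move=> Hb Ht Hc.
have tc i s : i <= N -> vis (vf i) (mf i) s ->
    test_cost s (var_reg x) (var_reg y) <= 2 * bitlen X.
  move=> iN [Hs _]; rewrite /test_cost !Hs ?var_reg_lt // mul2n -addnn.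
  by rewrite leq_add // bitlen_le // (bounded_nth _ (Hb i iN)).
have tt i s : i <= N -> vis (vf i) (mf i) s ->
    test_lt s (var_reg x) (var_reg y) = (i < N).
  by move=> iN [Hs _]; rewrite /test_lt !Hs ?var_reg_lt // Ht.
suff G k i : i + k = N ->
    runs X (vf i) (mf i) (while x y c) (k * (t + 2) + 2) (vf N) (mf N).
  exact: G.
elim: k i => [|k IH] i.
  rewrite addn0 => -> s Hs; exists s, (test_cost s (var_reg x) (var_reg y)).
  split=> //; last exact: tc Hs.
  by apply: ExecWhileStop; rewrite (tt N) // ltnn.
rewrite addnS -addSn => ikN s Hs.
have iN : i < N by lia.
have [s1 [t1 [E1 T1 V1]]] := Hc i iN s Hs.
have [s2 [t2 [E2 T2 V2]]] := IH _ ikN s1 V1.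
exists s2, (test_cost s (var_reg x) (var_reg y) + t1 + t2); split=> //.
  by apply: ExecWhileLoop E1 E2; rewrite (tt i) // ltnW.
have := tc i s (ltnW iN) Hs; move: T1 T2.
rewrite (mulSn k) -addnA 2!mulnDl; lia.
Qed.

(** The state is a function of the prefix already executed, so that an invariant can refer to the
    vertices that are done. *)
Lemma runs_seqs (I : Type) (r : seq I) (P : I -> program) (t : I -> nat)
    (vf : seq I -> seq nat) (mf : seq I -> nat -> nat) :
  (forall r1 i r2, r = r1 ++ i :: r2 ->
     runs X (vf r1) (mf r1) (P i) (t i) (vf (rcons r1 i)) (mf (rcons r1 i))) ->
  runs X (vf [::]) (mf [::]) (seqs (map P r)) (\sum_(i <- r) t i + 1) (vf r) (mf r).
Proof.
move=> H.
suff G r2 r1 : r = r1 ++ r2 ->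
    runs X (vf r1) (mf r1) (seqs (map P r2)) (\sum_(i <- r2) t i + 1) (vf r) (mf r).
  exact: G.
elim: r2 r1 => [|i r2 IH] r1 E.
  by rewrite E cats0 big_nil; apply: runs_skip.
rewrite big_cons -addnA; apply: runs_seq (H _ _ _ E) _.
by apply: IH; rewrite cat_rcons.
Qed.

End Runs.

(** * Comparisons as sums of key equalities *)

(* For [a < b] the unique contributing level is the position of the highest bit
   in which [a] and [b] differ. *)
Lemma sum_level_lt (L a b : nat) : b < 2 ^ L ->
  \sum_(l < L) (a %/ 2 ^ l + 1 == b %/ 2 ^ l * (b %/ 2 ^ l %% 2)) = (a < b).
Proof.
elim: L a b => [|L IH] a b.
  by rewrite expn0 big_ord0 ltnS leqn0 => /eqP ->; rewrite ltn0.
(* Level 0 contributes exactly when [b] is odd and [a + 1 = b], that is, when the halves agree and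
   only the lowest bits differ, in favour of [b]. The other levels compare the halves. *)
rewrite expnS => bL; rewrite big_ord_recl /= expn0 !divn1.
under eq_bigr => l _ do rewrite /bump /= add1n expnS !divnMA.
rewrite IH; last by rewrite ltn_divLR // mulnC.
have := divn_eq b 2; have := ltn_pmod b (isT : 0 < 2).
have := divn_eq a 2; have := ltn_pmod a (isT : 0 < 2).
move: (b %% 2) (b %/ 2) (a %% 2) (a %/ 2) => [|[|b0]] b1 a0 a1 // a02 -> _ ->.
  by rewrite muln0 addn1; lia.
rewrite muln1; lia.
Qed.

Lemma sum_ord_mul (M L : nat) (F : nat -> nat) :
  \sum_(i < M * L) F i = \sum_(q < M) \sum_(l < L) F (q * L + l).
Proof.
elim: M => [|M IH]; first by rewrite !big_ord0.
rewrite big_ord_recr -IH /= mulSn addnC big_split_ord /=; congr addn.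
Qed.

(** * Base-[n] coding of tuples *)

Definition digit (n t i : nat) : nat := t %/ n ^ i %% n.

Definition encode (n s : nat) (x : nat -> nat) : nat := \sum_(i < s) x i * n ^ i.

Lemma encodeS (n s : nat) (x : nat -> nat) :
  encode n s.+1 x = encode n s (fun i => x i.+1) * n + x 0.
Proof.
rewrite /encode big_ord_recl /= expn0 muln1 addnC; congr addn.
rewrite big_distrl; apply: eq_bigr => i _.
by rewrite /bump /= add1n expnSr mulnA.
Qed.

Lemma digitS (n t i : nat) : digit n t i.+1 = digit n (t %/ n) i.
Proof. by rewrite /digit expnS divnMA. Qed.

Lemma digit0 (n t : nat) : digit n t 0 = t %% n.
Proof. by rewrite /digit expn0 divn1. Qed.

Lemma digit_encode (n s i : nat) (x : nat -> nat) :
  (forall j, j < s -> x j < n) -> i < s -> digit n (encode n s x) i = x i.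
Proof.
elim: s i x => [|s IH] i x // Hx Hi.
have x0 := Hx 0 isT; have n0 : 0 < n by case: (n) x0.
rewrite encodeS; case: i Hi => [_|i Hi].
  by rewrite digit0 modnMDl modn_small.
rewrite digitS divnMDl // divn_small // addn0 IH // => j Hj; exact: Hx.
Qed.

Lemma encode_lt (n s : nat) (x : nat -> nat) :
  (forall j, j < s -> x j < n) -> encode n s x < n ^ s.
Proof.
elim: s x => [|s IH] x Hx; first by rewrite /encode big_ord0.
have x0 := Hx 0 isT; rewrite encodeS expnSr.
have := IH (fun i => x i.+1) (fun j Hj => Hx j.+1 Hj); nia.
Qed.

Lemma encode_digit (n s t : nat) : t < n ^ s -> encode n s (digit n t) = t.
Proof.
elim: s t => [|s IH] t; first by rewrite /encode big_ord0; case: t.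
case: (posnP n) => [->|n0]; first by rewrite exp0n.
rewrite expnSr => tn; rewrite encodeS digit0 [RHS](divn_eq t n).
congr (_ * _ + _); rewrite -[RHS]IH ?ltn_divLR //.
by apply: eq_bigr => i _; rewrite digitS.
Qed.

Lemma digit_lt (n t i : nat) : 0 < n -> digit n t i < n.
Proof. by move=> n0; rewrite ltn_pmod. Qed.

Lemma eq_encode (n s : nat) (x y : nat -> nat) :
  (forall i, i < s -> x i = y i) -> encode n s x = encode n s y.
Proof. by move=> xy; apply: eq_bigr => i _; rewrite xy. Qed.

(* [CrossAtom dir e y i j] compares coordinate [i] of a parent tuple with
   coordinate [j] of a child tuple, abscissas or ordinates according to [y]:
   parent < child + e if [dir], child < parent + e otherwise. *)
Record cross_atom := CrossAtom {
  ca_dir : bool; ca_eq : bool; ca_y : bool; ca_i : nat; ca_j : nat }.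

(** * Key vectors of tuples *)

Section Keys.
Variables (n L : nat) (f : nat -> nat).

(* A tuple of [s] points of the permutation is the number [t < n ^ s] whose
   base-[n] digits are their abscissas. *)
Definition coord (t : nat) (y : bool) (i : nat) : nat :=
  if y then f (digit n t i) else digit n t i.

Definition cross_holds (t t' : nat) (c : cross_atom) : bool :=
  let a := coord t (ca_y c) (ca_i c) in
  let b := coord t' (ca_y c) (ca_j c) in
  if ca_dir c then a < b + ca_eq c else b < a + ca_eq c.

Definition lower_key (l a : nat) : nat := a %/ 2 ^ l + 1.
Definition upper_key (l b : nat) : nat := b %/ 2 ^ l * (b %/ 2 ^ l %% 2).

(** The side claimed to be smaller receives the lower key, the other side the upper key; the slack
    [ca_eq c] goes to the larger side. *)
Definition cross_key (parent : bool) (c : cross_atom) (l t : nat) : nat :=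
  let a := coord t (ca_y c) (if parent then ca_i c else ca_j c) in
  if ca_dir c == parent then lower_key l a else upper_key l (a + ca_eq c).

(** A mixed-radix number whose digits alternate between a level (radix [L]) and the key at that
    level (radix [n + 1]). Recording the levels keeps keys taken at different level vectors
    apart. *)
Fixpoint keys (parent : bool) (cs : seq cross_atom) (lam t : nat) : nat :=
  if cs is c :: cs' then
    lam %% L + L * (cross_key parent c (lam %% L) t
                    + (n + 1) * keys parent cs' (lam %/ L) t)
  else 0.

Hypothesis n_gt0 : 0 < n.
Hypothesis L_gt0 : 0 < L.
Hypothesis n_lt : n < 2 ^ L.
Hypothesis f_lt : forall x, x < n -> f x < n.

Lemma coord_lt (t : nat) (y : bool) (i : nat) : coord t y i < n.
Proof. by rewrite /coord; case: y; rewrite ?f_lt ?digit_lt. Qed.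

(** Radix [n + 1] suffices: since [a < n], neither [a + 1] nor [a + ca_eq c] exceeds [n]. *)
Lemma cross_key_lt (parent : bool) (c : cross_atom) (l t : nat) :
  cross_key parent c l t < n + 1.
Proof.
rewrite /cross_key; set a := coord _ _ _; have an : a < n by apply: coord_lt.
have := leq_div a (2 ^ l); have := leq_div (a + ca_eq c) (2 ^ l).
have := ltn_pmod ((a + ca_eq c) %/ 2 ^ l) (isT : 0 < 2).
rewrite /lower_key /upper_key; move: (ca_eq c) => e.
case: eqP => _; last by case: e; nia.
lia.
Qed.

Lemma sum_cross_key (c : cross_atom) (t t' : nat) :
  \sum_(l < L) (cross_key true c l t == cross_key false c l t') =
  cross_holds t t' c.
Proof.
rewrite /cross_key /cross_holds; set a := coord t _ _; set b := coord t' _ _.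
have an : a < n by apply: coord_lt.
have bn : b < n by apply: coord_lt.
case: (ca_dir c) => /=; rewrite -(@sum_level_lt L) //;
  try by [move: (ca_eq c) => []; lia].
by apply: eq_bigr => l _; rewrite eq_sym.
Qed.

Lemma keys_cons (parent : bool) (c : cross_atom) (cs : seq cross_atom)
    (q l t : nat) : l < L ->
  keys parent (c :: cs) (q * L + l) t =
  l + L * (cross_key parent c l t + (n + 1) * keys parent cs q t).
Proof.
by move=> lL /=; rewrite modnMDl modn_small // divnMDl // divn_small // addn0.
Qed.

Lemma eq_radix (b q q' l l' : nat) : l < b -> l' < b ->
  (l + b * q == l' + b * q') = (l == l') && (q == q').
Proof.
move=> lb lb'; apply/eqP/andP => [E|[/eqP -> /eqP ->]] //.
have b0 : 0 < b by case: (b) lb.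
rewrite ![_ + b * _]addnC ![b * _]mulnC in E.
split; apply/eqP.
  by have := congr1 (modn^~ b) E; rewrite /= !modnMDl !modn_small.
by have := congr1 (divn^~ b) E; rewrite /= !divnMDl // !divn_small // !addn0.
Qed.

(** Equal keys have equal levels, so only the diagonal of the double sum contributes, and there it
    factors into the sums of [sum_cross_key], one per comparison. *)
Lemma sum_keys (cs : seq cross_atom) (t t' : nat) :
  \sum_(lam < L ^ size cs) \sum_(lam' < L ^ size cs)
     (keys true cs lam t == keys false cs lam' t') =
  all (cross_holds t t') cs.
Proof.
elim: cs => [|c cs IH]; first by rewrite !big_ord1.
have EL : L ^ size (c :: cs) = L ^ size cs * L by rewrite /= expnSr.
have inner q l : l < L ->
    \sum_(lam' < L ^ size cs * L)
      (keys true (c :: cs) (q * L + l) t == keys false (c :: cs) lam' t') =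
    (\sum_(q' < L ^ size cs) (keys true cs q t == keys false cs q' t')) *
    (cross_key true c l t == cross_key false c l t').
  move=> lL.
  rewrite (sum_ord_mul _ _ (fun x => keys true (c :: cs) (q * L + l) t ==
                                     keys false (c :: cs) x t')).
  rewrite big_distrl; apply: eq_bigr => q' _.
  rewrite (bigD1 (Ordinal lL)) // big1 ?addn0 => [|l' nl'].
    rewrite !keys_cons // eq_radix // eqxx andTb eq_radix ?cross_key_lt //.
    by rewrite /= mulnC mulnb addn0.
  by rewrite !keys_cons // eq_radix // eq_sym [_ == _](negbTE nl').
rewrite EL (sum_ord_mul _ _ (fun x => \sum_(lam' < L ^ size cs * L)
  (keys true (c :: cs) x t == keys false (c :: cs) lam' t'))).
under eq_bigr => q _ do under eq_bigr => l _ do rewrite inner //.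
under eq_bigr => q _ do rewrite -big_distrr sum_cross_key.
by rewrite -big_distrl IH /= mulnC mulnb.
Qed.

End Keys.

(** * Summation over labelings of a rooted tree *)

Section RootedTree.
Variables (V : finType) (r : V) (e : rel V).
Hypothesis e_root : forall u, ~~ e u r.
Hypothesis e_parent : forall u u' v, e u v -> e u' v -> u = u'.
Hypothesis e_connect : forall v, connect e r v.

Lemma connect_last (u v : V) :
  connect e u v -> u = v \/ exists2 w, connect e u w & e w v.
Proof.
case/connectP => p; case/lastP: p => [|p x] /=; first by move=> _ ->; left.
rewrite rcons_path last_rcons => /andP[Hp Hx] ->; right.
by exists (last u p) => //; apply/connectP; exists p.
Qed.

(* The parent of a vertex on a cycle is on that cycle, so a cycle would
   climb up to the root. *)
Lemma tree_acyclic (u v : V) : e u v -> ~~ connect e v u.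
Proof.
move=> uv; apply/negP => vu.
pose cyc w := exists2 w', connect e w w' & e w' w.
have up w z : cyc w -> e z w -> cyc z.
  case=> w' ww' w'w zw; have E := e_parent zw w'w; subst w'.
  case: (connect_last ww') => [E|[x wx xz]]; first by exists z; rewrite ?connect0 -?{2}E.
  by exists x => //; apply: connect_trans wx; apply: connect1.
have climb p x : path e x p -> cyc (last x p) -> cyc x.
  elim: p x => [|y p IH] x //= /andP[xy Hp] Hc; exact: up (IH _ Hp Hc) xy.
case/connectP: (e_connect v) => p Hp Ev.
have [|w _] := climb _ _ Hp; first by rewrite -Ev; exists u.
by rewrite (negbTE (e_root w)).
Qed.

(** The number of vertices reachable from [v]: a rank that drops along edges and never exceeds the
    number of vertices. *)
Definition height (v : V) : nat := #|connect e v|.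

Lemma height_lt (u v : V) : e u v -> height v < height u.
Proof.
move=> uv; apply: proper_card; apply/properP; split.
  by apply/subsetP => w; apply: connect_trans; apply: connect1.
by exists u; rewrite ?[u \in _]connect0 //; apply: tree_acyclic.
Qed.

Lemma height_gt0 (v : V) : 0 < height v.
Proof. by apply/card_gt0P; exists v; apply: connect0. Qed.

Lemma parent_exists (v : V) : v != r -> exists u, e u v.
Proof.
move=> vr; case: (connect_last (e_connect v)) => [E|[w _ wv]]; last by exists w.
by rewrite E eqxx in vr.
Qed.

(** * Elimination of vertices from the leaves upwards *)

Section Labelings.
Variables (A : finType) (d : A).

Definition relabel (a : {ffun V -> A}) (c : V) (t : A) : {ffun V -> A} :=
  [ffun v => if v == c then t else a v].

(** Labelings frozen at [d] on the eliminated set [E] stand for labelings of its complement, without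
    a change of type. *)
Definition fixed_on (E : {set V}) (a : {ffun V -> A}) : bool :=
  [forall v in E, a v == d].

Lemma sum_relabel (E : {set V}) (c : V) (F : {ffun V -> A} -> nat) :
  c \notin E ->
  \sum_(a | fixed_on E a) F a =
  \sum_(a | fixed_on (c |: E) a) \sum_t F (relabel a c t).
Proof.
move=> cE.
rewrite (partition_big (fun a => relabel a c d) (fixed_on (c |: E))) /=; last first.
  move=> a /forall_inP aE; apply/forall_inP => v; rewrite !inE ffunE.
  by case: (v =P c) => //= _ /aE.
apply: eq_bigr => a0 /forall_inP a0E.
rewrite (reindex_onto (fun t => relabel a0 c t) (fun a => a c)) /=; last first.
  move=> a /andP[_ /eqP <-]; apply/ffunP => v; rewrite !ffunE.
  by case: eqP => // ->.
apply: eq_bigl => t; rewrite ffunE eqxx eqxx andbT; apply/andP; split.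
  apply/forall_inP => v vE; rewrite ffunE; case: (v =P c) => [E'|_].
    by rewrite -E' vE in cE.
  by apply: a0E; rewrite !inE vE orbT.
apply/eqP/ffunP => v; rewrite !ffunE; case: eqP => // ->.
by apply/esym/eqP/a0E; rewrite !inE eqxx.
Qed.

Variables (wt : V -> A -> nat) (ew : V -> V -> A -> A -> nat).
Variable W : V -> A -> nat.
Hypothesis W_rec : forall v t,
  W v t = wt v t * \prod_(c | e v c) \sum_t' ew v c t t' * W c t'.

(** The message that an eliminated child [c] sends to its parent [u] labelled [t]. *)
Let Q (u c : V) (t : A) : nat := \sum_t' ew u c t t' * W c t'.

(** The local factor of [v] once [E] is eliminated: an edge into [E] contributes its message in
    place of its weight. *)
Let g (E : {set V}) (a : {ffun V -> A}) (v : V) : nat :=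
  if v \in E then 1 else
  wt v (a v) *
  \prod_(w | e v w) (if w \in E then Q v w (a v) else ew v w (a v) (a w)).

Let closed_down (E : {set V}) : Prop :=
  forall v w, v \in E -> e v w -> w \in E.

(** The children of [c] are already in [E], so by [W_rec] the local factor of [c] is [W c t]. Apart
    from it only the factor of [u] depends on [t], through the edge to [c]; summing over [t] turns
    this edge weight into the message. *)
Lemma eliminate_leaf (E : {set V}) (c u : V) (a : {ffun V -> A}) :
  closed_down E -> closed_down (c |: E) -> c \notin E -> e u c ->
  \sum_t \prod_v g E (relabel a c t) v = \prod_v g (c |: E) a v.
Proof.
move=> clE clE' cE uc.
have ucN : u != c by apply/eqP => E1; have := height_lt uc; rewrite E1 ltnn.
have uE : u \notin E by apply: contra cE => uE; apply: clE uc.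
pose B t := \prod_(v | (v != c) && (v != u)) g E (relabel a c t) v.
pose B' := \prod_(v | (v != c) && (v != u)) g (c |: E) a v.
have BE t : B t = B'.
  apply: eq_bigr => v /andP[vc vu]; rewrite /g !inE (negbTE vc) /=.
  case: ifP => // vE; rewrite ffunE (negbTE vc); congr muln.
  apply: eq_bigr => w vw; have wc : w != c.
    by apply: contra vu => /eqP wc; rewrite wc in vw; rewrite (e_parent vw uc).
  by rewrite !inE (negbTE wc) /= ffunE (negbTE wc).
pose R := \prod_(w | e u w && (w != c))
   (if w \in c |: E then Q u w (a u) else ew u w (a u) (a w)).
have lhs t : \prod_v g E (relabel a c t) v =
    ew u c (a u) t * W c t * (wt u (a u) * R * B').
  rewrite (bigD1 c) //= (bigD1 u) //= -/(B t) BE.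
  have -> : g E (relabel a c t) c = W c t.
    rewrite /g (negbTE cE) ffunE eqxx W_rec; congr muln.
    apply: eq_bigr => w cw; rewrite ifT //.
    have := clE' c w; rewrite !inE eqxx cw => /(_ isT isT) /orP[/eqP E1|//].
    by have := height_lt cw; rewrite E1 ltnn.
  have -> : g E (relabel a c t) u = wt u (a u) * (ew u c (a u) t * R).
    rewrite /g (negbTE uE) ffunE (negbTE ucN); congr muln.
    rewrite (bigD1 c) //= (negbTE cE) ffunE eqxx; congr muln.
    apply: eq_bigr => w /andP[_ wc].
    by rewrite !inE (negbTE wc) /= ffunE (negbTE wc).
  by rewrite -!mulnA; nia.
under eq_bigr => t _ do rewrite lhs.
rewrite -big_distrl /= -/(Q u c (a u)).
rewrite [RHS](bigD1 c) //= [X in _ = _ * X](bigD1 u) //= -/B'.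
have -> : g (c |: E) a c = 1 by rewrite /g !inE eqxx.
have -> : g (c |: E) a u = wt u (a u) * (Q u c (a u) * R).
  rewrite /g !inE (negbTE ucN) (negbTE uE) /=; congr muln.
  by rewrite (bigD1 c) //= !inE eqxx.
by rewrite -!mulnA mul1n; nia.
Qed.

Lemma sum_eliminated (k : nat) (E : {set V}) :
  #|E| = k -> closed_down E -> r \notin E ->
  \sum_a \prod_v g set0 a v = \sum_(a | fixed_on E a) \prod_v g E a v.
Proof.
elim: k E => [|k IH] E.
  move/eqP; rewrite cards_eq0 => /eqP -> _ _; apply: eq_bigl => a.
  by apply/esym/forall_inP => v; rewrite inE.
move=> Ek clE rE.
have [v0 v0E] : exists v, v \in E by apply/card_gt0P; rewrite Ek.
(* The parent of a vertex of largest height lies outside [E], so [E] stays closed under children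
   when that vertex is removed. *)
pose c := [arg max_(v > v0 in E) height v].
have [cE cmax] : c \in E /\ forall v, v \in E -> height v <= height c.
  by rewrite /c; case: arg_maxnP.
have clc : closed_down (E :\ c).
  move=> v w; rewrite !inE => /andP[vc vE] vw; rewrite (clE v w) // andbT.
  by apply/eqP => wc; have := height_lt vw; rewrite wc ltnNge cmax.
have cr : c != r by apply: contra rE => /eqP <-.
have [u uc] := parent_exists cr.
rewrite (IH (E :\ c)) //; first last.
- by rewrite !inE negb_and rE orbT.
- by have := cardsD1 c E; rewrite cE Ek; lia.
rewrite (@sum_relabel _ c) ?setD1K // ?inE ?eqxx //.
apply: eq_bigr => a _; rewrite (@eliminate_leaf _ c u) ?setD1K // ?inE ?eqxx //.
Qed.

Theorem sum_tree_labelings :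
  \sum_(a : {ffun V -> A})
     (\prod_v wt v (a v)) * \prod_u \prod_(v | e u v) ew u v (a u) (a v) =
  \sum_t W r t.
Proof.
transitivity (\sum_a \prod_v g set0 a v).
  apply: eq_bigr => a _; rewrite -big_split; apply: eq_bigr => v _ /=.
  by rewrite /g inE; congr muln; apply: eq_bigr => w _; rewrite inE.
(* All vertices but the root are eliminated; a labeling frozen on them is determined by its label at
   the root. *)
rewrite (@sum_eliminated _ [set~ r] erefl); last by rewrite !inE eqxx.
  rewrite (@sum_relabel _ r) ?inE ?eqxx //.
  rewrite (big_pred1 [ffun=> d]) => [|a]; last first.
    apply/forall_inP/eqP => [H|-> v _]; last by rewrite ffunE.
    by apply/ffunP => v; rewrite ffunE; apply/eqP/H; rewrite !inE; case: (v == r).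
  apply: eq_bigr => t _; rewrite (bigD1 r) //= big1 ?muln1 => [|v vr].
    rewrite /g !inE eqxx /= ffunE eqxx W_rec; congr muln; apply: eq_bigr => w rw.
    rewrite ifT // !inE; apply/eqP => wr; have := e_root r.
    by rewrite -{2}wr rw.
  by rewrite /g !inE vr.
move=> v w _ vw; rewrite !inE; apply/eqP => wr.
by have := e_root v; rewrite -wr vw.
Qed.

End Labelings.
End RootedTree.

(** * Occurrences as labelings of the pattern-tree *)

Lemma prodn_bool (I : finType) (P : pred I) (F : I -> bool) :
  \prod_(i | P i) (F i : nat) = [forall (i | P i), F i].
Proof.
by rewrite -big_andE (big_morph nat_of_bool (fun x y => esym (mulnb x y)) erefl).
Qed.

Lemma sum_ord_lt (N M : nat) (F : nat -> nat) :
  N <= M -> \sum_(t < M) (t < N) * F t = \sum_(t < N) F t.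
Proof.
move=> NM; rewrite [RHS](big_ord_widen _ _ NM) [RHS]big_mkcond /=.
by apply: eq_bigr => t _; case: ifP => _; rewrite ?mul1n.
Qed.

Definition perm_fun (n : nat) (pi : 'S_n) (a : nat) : nat :=
  if insub a is Some i then nat_of_ord (pi i) else 0.

Lemma perm_funE (n : nat) (pi : 'S_n) (i : 'I_n) : perm_fun pi i = pi i.
Proof. by rewrite /perm_fun valK. Qed.

Lemma perm_fun_lt (n : nat) (pi : 'S_n) (a : nat) :
  a < n -> perm_fun pi a < n.
Proof. by move=> an; rewrite (perm_funE pi (Ordinal an)). Qed.

Lemma perm_fun_default (n : nat) (pi : 'S_n) (a : nat) :
  n <= a -> perm_fun pi a = 0.
Proof. by move=> na; rewrite /perm_fun insubF // ltnNge na. Qed.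

(** * Constraints as lists of comparisons *)

Section Atoms.
Variable T : pattern_tree.
Implicit Types u v w : vertex T.

Definition poset (y : bool) u v : rel ('I_(vsize u) + 'I_(vsize v)) :=
  if y then yposet T u v else xposet T u v.

(* All constraints on the points of [v] alone; the posets labelling the edges
   at [v] contribute to them. *)
Definition inner_lt v (y : bool) (i j : 'I_(vsize v)) : bool :=
  [|| if y then vlabel v i < vlabel v j else i < j,
      [exists u, edge T u v && poset y (inr i : 'I_(vsize u) + _) (inr j)] |
      [exists w, edge T v w && poset y (inl i : _ + 'I_(vsize w)) (inl j)]].

Definition inner_atoms v : seq (bool * nat * nat) :=
  [seq (p.1.1, nat_of_ord p.1.2, nat_of_ord p.2)
     | p <- enum [pred p : bool * 'I_(vsize v) * 'I_(vsize v)
                    | inner_lt p.1.1 p.1.2 p.2]].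

(* An equality of points is the pair of inequalities [a < b + 1] and
   [b < a + 1]. *)
Definition cross_lt u v (dir eq y : bool) (i : 'I_(vsize u)) (j : 'I_(vsize v)) :
    bool :=
  if eq then (i, j) \in eqpoints T u v
  else if dir then poset y (inl i) (inr j) else poset y (inr j) (inl i).

Definition cross_atoms u v : seq cross_atom :=
  [seq CrossAtom p.1.1.1.1 p.1.1.1.2 p.1.1.2 (nat_of_ord p.1.2) (nat_of_ord p.2)
     | p <- enum [pred p : bool * bool * bool * 'I_(vsize u) * 'I_(vsize v)
                    | cross_lt p.1.1.1.1 p.1.1.1.2 p.1.1.2 p.1.2 p.2]].

(** Parents are unique, so the comparisons along an edge can be indexed by its lower end; the root
    gets none. *)
Definition up_atoms v : seq cross_atom :=
  if [pick u | edge T u v] is Some u then cross_atoms u v else [::].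

Lemma up_atomsE u v : edge T u v -> up_atoms v = cross_atoms u v.
Proof.
move=> uv; rewrite /up_atoms; case: pickP => [w wv|/(_ u)]; last by rewrite uv.
by rewrite (edge_parent wv uv).
Qed.

Lemma up_atoms_root : up_atoms (root T) = [::].
Proof.
by rewrite /up_atoms; case: pickP => // u; rewrite (negbTE (edge_root u)).
Qed.

(** * Weights of subtrees *)

Section Weights.
Variables (n : nat) (f : nat -> nat).

Definition inner_holds (t : nat) (a : bool * nat * nat) : bool :=
  coord n f t a.1.1 a.1.2 < coord n f t a.1.1 a.2.

Definition inner_ok v (t : nat) : bool := all (inner_holds t) (inner_atoms v).

Definition edge_ok v (t t' : nat) : bool :=
  all (cross_holds n f t t') (up_atoms v).

(** The tree is given by a relation and offers no structural recursion, so [k] serves as fuel; every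
    amount from [height (edge T) v] on gives the same value. *)
Fixpoint weight_rec (k : nat) v (t : nat) : nat :=
  if k is k'.+1 then
    inner_ok v t * \prod_(c | edge T v c)
      \sum_(t' < n ^ vsize c) edge_ok c t t' * weight_rec k' c t'
  else 0.

(* The number of occurrences of the subtree rooted at [v] that place its root
   tuple at [t]. *)
Definition weight v (t : nat) : nat := weight_rec #|vertex T| v t.

Definition query v (t : nat) : nat :=
  \sum_(t' < n ^ vsize v) edge_ok v t t' * weight v t'.

Lemma tree_height_lt u v :
  edge T u v -> height (edge T) v < height (edge T) u.
Proof.
apply: (@height_lt _ (root T)).
- exact: edge_root.
- exact: edge_parent.
- exact: edge_connect.
Qed.

Lemma weight_rec_stable (k k' : nat) v t :
  height (edge T) v <= k -> height (edge T) v <= k' ->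
  weight_rec k v t = weight_rec k' v t.
Proof.
elim: k k' v t => [|k IH] [|k'] v t; rewrite ?leqn0 ?(gtn_eqF (height_gt0 _ _)) //.
move=> vk vk' /=; congr muln; apply: eq_bigr => c vc; apply: eq_bigr => t' _.
by rewrite (IH k') //; have := tree_height_lt vc; lia.
Qed.

Lemma weightE v t :
  weight v t = inner_ok v t * \prod_(c | edge T v c) query c t.
Proof.
have hV w : height (edge T) w <= #|vertex T| by apply: max_card.
by rewrite /weight (weight_rec_stable (k' := #|vertex T|.+1)) // ltnW // ltnS.
Qed.

End Weights.

(** * Correspondence between occurrences and labelings by tuples *)

Section Count.
Variables (n : nat) (pi : 'S_n).
Hypothesis n_gt0 : 0 < n.
Let f := perm_fun pi.
Let M := n ^ max_size T.

Lemma vsize_max v : vsize v <= max_size T.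
Proof. exact: (@leq_bigmax _ (fun v => vsize v)). Qed.

Lemma expn_vsize_max v : n ^ vsize v <= M.
Proof. by rewrite leq_pexp2l // vsize_max. Qed.

Let M_gt0 : 0 < M. Proof. by rewrite expn_gt0 n_gt0. Qed.

Definition decode_point (a : {ffun vertex T -> 'I_M}) (p : tree_point T) : 'I_n :=
  Ordinal (digit_lt (a (tag p)) (tagged p) n_gt0).

Definition decode_occ (a : {ffun vertex T -> 'I_M}) :
    {ffun tree_point T -> 'I_n * 'I_n} :=
  [ffun p => (decode_point a p, pi (decode_point a p))].

Definition abscissa (phi : {ffun tree_point T -> 'I_n * 'I_n}) v (i : nat) : nat :=
  if insub i is Some j then nat_of_ord (phi (@vpoint T v j)).1 else 0.

Lemma abscissa_lt phi v (i : nat) : abscissa phi v i < n.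
Proof. by rewrite /abscissa; case: insub. Qed.

Lemma encode_abscissa_lt phi v : encode n (vsize v) (abscissa phi v) < M.
Proof.
apply: leq_trans (expn_vsize_max v); apply: encode_lt => j _.
exact: abscissa_lt.
Qed.

Definition encode_occ (phi : {ffun tree_point T -> 'I_n * 'I_n}) :
    {ffun vertex T -> 'I_M} :=
  [ffun v => Ordinal (encode_abscissa_lt phi v)].

(** A point of the permutation is determined by its abscissa, which is why tuples record abscissas
    only. *)
Lemma encode_occK (phi : {ffun tree_point T -> 'I_n * 'I_n}) : [forall p, phi p \in perm_points pi] ->
  decode_occ (encode_occ phi) = phi.
Proof.
move=> /forallP Hphi; apply/ffunP => -[v i]; rewrite -/(vpoint i) ffunE.
have -> : decode_point (encode_occ phi) (vpoint i) = (phi (vpoint i)).1.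
  apply: val_inj; rewrite /= ffunE /= digit_encode // => [|j _].
    by rewrite /abscissa valK.
  exact: abscissa_lt.
by case/imsetP: (Hphi (vpoint i)) => x _ ->.
Qed.

(** All vertices share the label type ['I_M], and decoding reads only the lowest [vsize v] digits;
    labels too large for their vertex are the ones that do not come back. *)
Lemma decode_occK (a : {ffun vertex T -> 'I_M}) :
  (encode_occ (decode_occ a) == a) = [forall v, a v < n ^ vsize v].
Proof.
have E v : encode n (vsize v) (abscissa (decode_occ a) v) =
           encode n (vsize v) (digit n (a v)).
  apply: eq_encode => i iv; rewrite /abscissa.
  by rewrite (insubT (fun i => i < vsize v) iv) /= ffunE.
apply/eqP/forallP => [<- v|H].
  rewrite ffunE /=; apply: encode_lt => j _; exact: abscissa_lt.
by apply/ffunP => v; apply: val_inj; rewrite ffunE /= E encode_digit.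
Qed.

Let pcoord (y : bool) (p : 'I_n * 'I_n) : 'I_n := if y then p.2 else p.1.

Lemma coord_decode (a : {ffun vertex T -> 'I_M}) v (y : bool) (i : 'I_(vsize v)) :
  coord n f (a v) y i = pcoord y (decode_occ a (vpoint i)).
Proof.
by rewrite /coord /pcoord ffunE; case: y => //=; rewrite -perm_funE.
Qed.

Lemma inner_okP (a : {ffun vertex T -> 'I_M}) v :
  reflect (forall y i j, inner_lt y i j ->
             pcoord y (decode_occ a (@vpoint T v i)) <
             pcoord y (decode_occ a (vpoint j)))
          (inner_ok n f v (a v)).
Proof.
rewrite /inner_ok /inner_atoms all_map; apply: (iffP allP) => [H y i j ij|H].
  have := H (y, i, j); rewrite mem_enum inE /= => /(_ ij).
  by rewrite /inner_holds /= !coord_decode.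
move=> [[y i] j]; rewrite mem_enum inE /= => /H.
by rewrite /inner_holds /= !coord_decode.
Qed.

Lemma edge_okP (a : {ffun vertex T -> 'I_M}) u v : edge T u v ->
  reflect (forall (dir eq y : bool) i j, cross_lt dir eq y i j ->
             let p := pcoord y (decode_occ a (@vpoint T u i)) in
             let q := pcoord y (decode_occ a (@vpoint T v j)) in
             if dir then p < q + eq else q < p + eq)
          (edge_ok n f v (a u) (a v)).
Proof.
move=> uv; rewrite /edge_ok (up_atomsE uv) /cross_atoms all_map.
apply: (iffP allP) => [H dir eq y i j ij|H].
  have := H (dir, eq, y, i, j); rewrite mem_enum inE /= => /(_ ij).
  by rewrite /cross_holds /= !coord_decode.
move=> [[[[dir eq] y] i] j]; rewrite mem_enum inE /= => /H.
by rewrite /cross_holds /= !coord_decode.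
Qed.

Lemma decode_occ_eq (a : {ffun vertex T -> 'I_M}) (p q : tree_point T) :
  (decode_occ a p == decode_occ a q) =
  (pcoord false (decode_occ a p) == pcoord false (decode_occ a q)).
Proof.
apply/eqP/eqP => [-> //|]; rewrite !ffunE /pcoord /= => E.
by rewrite E.
Qed.

Lemma occurrence_decode (a : {ffun vertex T -> 'I_M}) :
  occurrence pi (decode_occ a) =
  [forall v, inner_ok n f v (a v)] &&
  [forall u, forall (v | edge T u v), edge_ok n f v (a u) (a v)].
Proof.
apply/and3P/andP => [[_ /forallP Hv /forallP He]|[/forallP Hv /forallP He]].
  have {}He u v : edge T u v ->
     poset_constraints (decode_occ a) u v /\ eq_constraints (decode_occ a) u v.
    by move=> uv; have /forallP/(_ v)/implyP/(_ uv)/andP := He u.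
  have pos u v y z z' : edge T u v -> poset y z z' ->
      pcoord y (decode_occ a (@epoint T u v z)) <
      pcoord y (decode_occ a (epoint z')).
    move=> /He[/forallP/(_ z)/forallP/(_ z')/andP[/implyP Hx /implyP Hy] _].
    by rewrite /poset /pcoord; case: y.
  split.
    apply/forallP => v; apply/inner_okP => y i j /or3P[ij|/existsP[u /andP[uv ij]]|/existsP[w /andP[vw ij]]].
    - have /forallP/(_ i)/forallP/(_ j)/andP[/implyP Hx /implyP Hy] := Hv v.
      by rewrite /pcoord; case: y ij.
    - exact: (pos u v y (inr i) (inr j)).
    - exact: (pos v w y (inl i) (inl j)).
  apply/forallP => u; apply/forall_inP => v uv; apply/edge_okP => // dir eq y i j.
  rewrite /cross_lt; case: eq => [ij|].
    have [_ /forallP/(_ i)/forallP/(_ j)/implyP/(_ ij)/eqP ->] := He u v uv.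
    by case: dir; rewrite /= addn1.
  by case: dir => ij /=; rewrite addn0; apply: (pos u v _ _ _ uv ij).
have {}He u v : edge T u v -> edge_ok n f v (a u) (a v).
  by move=> uv; have /forall_inP/(_ v uv) := He u.
have pos u v y z z' : edge T u v -> poset y z z' ->
    pcoord y (decode_occ a (@epoint T u v z)) <
    pcoord y (decode_occ a (epoint z')).
  move=> uv; case: z => i; case: z' => j ij /=.
  - apply: (inner_okP _ _ (Hv u)); apply/or3P/Or33/existsP; exists v.
    by rewrite uv.
  - by have := edge_okP a uv (He u v uv) true false y i j ij; rewrite /= addn0.
  - by have := edge_okP a uv (He u v uv) false false y j i ij; rewrite /= addn0.
  - apply: (inner_okP _ _ (Hv v)); apply/or3P/Or32/existsP; exists u.
    by rewrite uv.
split.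
- by apply/forallP => p; rewrite ffunE; apply/imsetP; exists (decode_point a p).
- apply/forallP => v; apply/forallP => i; apply/forallP => j.
  apply/andP; split; apply/implyP => ij.
    by apply: (inner_okP _ _ (Hv v) false); apply/or3P/Or31.
  by apply: (inner_okP _ _ (Hv v) true); apply/or3P/Or31.
apply/forallP => u; apply/forallP => v; apply/implyP => uv; apply/andP; split.
  apply/forallP => z; apply/forallP => z'; apply/andP; split; apply/implyP => zz'.
    exact: (pos u v false).
  exact: (pos u v true).
apply/forallP => i; apply/forallP => j; apply/implyP => ij.
(* Abscissas determine points, and the two inequalities [p < q + 1] and [q < p + 1] make them
   equal. *)
rewrite decode_occ_eq; apply/eqP/val_inj => /=.
have := edge_okP a uv (He u v uv) true true false i j ij.
have := edge_okP a uv (He u v uv) false true false i j ij.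
by rewrite /= !addn1 !ltnS => h1 h2; apply/eqP; rewrite eqn_leq h1 h2.
Qed.

(** This is [sum_tree_labelings] with indicators as weights; the factor [t < n ^ vsize v] confines
    each label to the actual tuples of its vertex. *)
Lemma count_occ_pos :
  count_occ T pi = \sum_(t < n ^ vsize (root T)) weight n f (root T) t.
Proof.
pose wt v (t : 'I_M) : nat := (t < n ^ vsize v) && inner_ok n f v t.
pose ew (u v : vertex T) (t t' : 'I_M) : nat := edge_ok n f v t t'.
pose W v (t : 'I_M) : nat := (t < n ^ vsize v) * weight n f v t.
have Wrec v t : W v t = wt v t * \prod_(c | edge T v c) \sum_t' ew v c t t' * W c t'.
  rewrite /W /wt weightE mulnA mulnb; congr muln; apply: eq_bigr => c _.
  rewrite /query; have /= <- := sum_ord_lt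
    (fun t' => edge_ok n f c t t' * weight n f c t') (expn_vsize_max c).
  by apply: eq_bigr => t' _; rewrite /ew /W; lia.
have := sum_tree_labelings (@edge_root T) (@edge_parent T) (@edge_connect T)
          (Ordinal M_gt0) Wrec.
have /= <- := sum_ord_lt (weight n f (root T)) (expn_vsize_max (root T)).
move=> <-.
rewrite /count_occ -sum1_card.
under eq_bigl => phi do rewrite inE.
(* Occurrences become the labelings that satisfy the constraints and are unchanged by decoding and
   re-encoding, that is, whose labels are all in range. *)
rewrite (reindex_onto decode_occ encode_occ) /=; last first.
  by move=> phi /and3P[Hphi _ _]; apply: encode_occK.
rewrite big_mkcond /=; apply: eq_bigr => a _.
rewrite occurrence_decode decode_occK prodn_bool.
under [X in _ * X]eq_bigr => u _ do rewrite prodn_bool.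
rewrite prodn_bool mulnb.
have -> : [forall i, (a i < n ^ vsize i) && inner_ok n f i (a i)] =
    [forall v, inner_ok n f v (a v)] && [forall v, a v < n ^ vsize v].
  apply/forallP/andP => [H|[/forallP H1 /forallP H2] v]; last by rewrite H1 H2.
  by split; apply/forallP => v; case/andP: (H v).
by rewrite andbAC; case: (_ && _).
Qed.

End Count.

Theorem count_occ_weight (n : nat) (pi : 'S_n) :
  count_occ T pi =
  \sum_(t < n ^ vsize (root T)) weight n (perm_fun pi) (root T) t.
Proof.
(* For [n = 0] there is nothing to map to, while the root has at least one point, so both sides
   vanish. *)
case: (posnP n) => [n0|/count_occ_pos -> //]; subst n.
rewrite exp0n ?vsize_gt0 // big_ord0; apply: eq_card0 => phi.
by case: (phi (vpoint (Ordinal (vsize_gt0 (root T))))) => -[].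
Qed.

End Atoms.

(** * The program *)

Definition powE (e : expr) (k : nat) : expr := iter k (EOp Mul e) (ECst 1).

Definition modE (a b : expr) : expr := EOp Sub a (EOp Mul (EOp Div a b) b).

(** Subtraction is truncated, so this evaluates to 1 if [a < b] and to 0 otherwise. *)
Definition ltE (a b : expr) : expr :=
  EOp Sub (ECst 1) (EOp Sub (ECst 1) (EOp Sub b a)).

Definition incE (x : var) : expr := EOp Add (EVar x) (ECst 1).

Definition digitE (i : nat) : expr :=
  modE (EOp Div (EVar Vt) (powE (EVar Vn) i)) (EVar Vn).

Definition coordE (y : bool) (i : nat) : expr :=
  if y then EMem (digitE i) else digitE i.

Definition pow2E (l : expr) : expr := EMem (EOp Add (EVar Vn) l).

Definition lower_keyE (l a : expr) : expr :=
  EOp Add (EOp Div a (pow2E l)) (ECst 1).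

Definition upper_keyE (l b : expr) : expr :=
  let q := EOp Div b (pow2E l) in EOp Mul q (modE q (ECst 2)).

Definition cross_keyE (parent : bool) (c : cross_atom) (l : expr) : expr :=
  let a := coordE (ca_y c) (if parent then ca_i c else ca_j c) in
  if ca_dir c == parent then lower_keyE l a
  else upper_keyE l (EOp Add a (ECst (ca_eq c))).

Fixpoint keysE (parent : bool) (cs : seq cross_atom) (lam : expr) : expr :=
  if cs is c :: cs' then
    let l := modE lam (EVar VL) in
    EOp Add l (EOp Mul (EVar VL)
      (EOp Add (cross_keyE parent c l)
         (EOp Mul (EOp Add (EVar Vn) (ECst 1))
            (keysE parent cs' (EOp Div lam (EVar VL))))))
  else ECst 0.

Definition acost (e : expr) : nat := ecost e + edeg e + 2.

Definition scost (a e : expr) : nat := ecost a + ecost e + edeg a + edeg e.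

Lemma ev_powE (v : seq nat) (m : nat -> nat) (e : expr) (k : nat) :
  ev v m (powE e k) = ev v m e ^ k.
Proof. by elim: k => //= k ->; rewrite expnS. Qed.

Lemma ev_modE (v : seq nat) (m : nat -> nat) (a b : expr) :
  ev v m (modE a b) = ev v m a %% ev v m b.
Proof. by rewrite /= {1}(divn_eq (ev v m a) (ev v m b)) addKn. Qed.

Lemma ev_ltE (v : seq nat) (m : nat -> nat) (a b : expr) :
  ev v m (ltE a b) = (ev v m a < ev v m b).
Proof. by rewrite /=; lia. Qed.

Lemma leq_sum_ord (a b : nat) (F : nat -> nat) :
  a <= b -> \sum_(i < a) F i <= \sum_(i < b) F i.
Proof.
move=> ab; rewrite (big_ord_widen _ _ ab) big_mkcond; apply: leq_sum => i _.
by case: ifP.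
Qed.

Section Program.
Variable T : pattern_tree.
Implicit Types u v w c : vertex T.

(** Cells below [n] hold the permutation, the next [L] cells the powers of 2, and the rest the
    table. The rank of [v] is the residue of the table index modulo the number of vertices, so
    distinct vertices never share a cell. *)
Definition addrE (parent : bool) v : expr :=
  EOp Add (EOp Add (EVar Vn) (EVar VL))
    (EOp Add (ECst (enum_rank v))
       (EOp Mul (ECst #|vertex T|) (keysE parent (up_atoms v) (EVar Vlam)))).

Definition boundE v : expr := powE (EVar VL) (size (up_atoms v)).

Definition innerE v : expr :=
  foldr (fun a => EOp Mul (ltE (coordE a.1.1 a.1.2) (coordE a.1.1 a.2)))
    (ECst 1) (inner_atoms v).

Definition gatherE v : expr := EOp Add (EVar Vacc) (EMem (addrE true v)).

Definition addE v : expr := EOp Add (EMem (addrE false v)) (EVar Vw).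

Definition mulE : expr := EOp Mul (EVar Vw) (EVar Vacc).

(** The weight under construction in [Vw] is multiplied by the sum of the cells read. The other
    variables used are reset, so that each query starts from the same configuration. *)
Definition query_prog v : program :=
  Seq (assign Vbd (boundE v))
 (Seq (while Vlam Vbd
         (Seq (assign Vacc (gatherE v)) (assign Vlam (incE Vlam))))
 (Seq (assign Vw mulE)
 (Seq (assign Vacc (ECst 0))
 (Seq (assign Vlam (ECst 0))
      (assign Vbd (ECst 0)))))).

Definition insert_prog v : program :=
  Seq (assign Vbd (boundE v))
 (Seq (while Vlam Vbd
         (Seq (store (addrE false v) (addE v)) (assign Vlam (incE Vlam))))
 (Seq (assign Vlam (ECst 0))
      (assign Vbd (ECst 0)))).

Definition children v : seq (vertex T) := enum [pred c | edge T v c].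

Definition tuple_prog v : program :=
  Seq (assign Vw (innerE v))
 (Seq (seqs (map query_prog (children v)))
 (Seq (insert_prog v)
 (Seq (assign Vw (ECst 0))
      (assign Vt (incE Vt))))).

Definition vertex_prog v : program :=
  Seq (assign VN (powE (EVar Vn) (vsize v)))
 (Seq (while Vt VN (tuple_prog v))
 (Seq (assign Vt (ECst 0))
      (assign VN (ECst 0)))).

(* Computes the number [L] of levels and stores [2 ^ l] in cell [n + l] for
   [l < L]. *)
Definition init_prog : program :=
  Seq (assign VN (EOp Add (EVar Vn) (ECst 2)))
 (Seq (assign Vt (ECst 1))
 (Seq (while Vt VN
        (Seq (store (EOp Add (EVar Vn) (EVar VL)) (EVar Vt))
        (Seq (assign Vt (EOp Mul (EVar Vt) (ECst 2)))
             (assign VL (incE VL)))))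
 (Seq (assign Vt (ECst 0))
      (assign VN (ECst 0))))).

(** Heights drop strictly along edges, so every child precedes its parent. *)
Definition bottom_up : seq (vertex T) :=
  sort (relpre (height (edge T)) leq) (enum (vertex T)).

Definition count_prog : program :=
  Seq init_prog
 (Seq (seqs (map vertex_prog bottom_up))
      (assign Vn (EMem (addrE false (root T))))).

(** * Time bounds for the pieces of the program *)

Definition query_time (L : nat) v : nat :=
  acost (boundE v) +
  (L ^ size (up_atoms v) * (acost (gatherE v) + acost (incE Vlam) + 2) + 2 +
  (acost mulE + (acost (ECst 0) + (acost (ECst 0) + acost (ECst 0))))).

Definition insert_time (L : nat) v : nat :=
  acost (boundE v) +
  (L ^ size (up_atoms v) * (scost (addrE false v) (addE v) + acost (incE Vlam) + 2)
   + 2 + (acost (ECst 0) + acost (ECst 0))).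

Definition tuple_time (L : nat) v : nat :=
  acost (innerE v) +
  (\sum_(c <- children v) query_time L c + 1 +
  (insert_time L v + (acost (ECst 0) + acost (incE Vt)))).

Definition vertex_time (n L : nat) v : nat :=
  acost (powE (EVar Vn) (vsize v)) +
  (n ^ vsize v * (tuple_time L v + 2) + 2 + (acost (ECst 0) + acost (ECst 0))).

Definition init_time (L : nat) : nat :=
  acost (EOp Add (EVar Vn) (ECst 2)) +
  (acost (ECst 1) +
  (L * (scost (EOp Add (EVar Vn) (EVar VL)) (EVar Vt) +
        (acost (EOp Mul (EVar Vt) (ECst 2)) + acost (incE VL)) + 2) + 2 +
  (acost (ECst 0) + acost (ECst 0)))).

Definition count_time (n L : nat) : nat :=
  init_time L +
  (\sum_(v <- bottom_up) vertex_time n L v + 1 +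
   acost (EMem (addrE false (root T)))).

Lemma bottom_up_uniq : uniq bottom_up.
Proof. by rewrite sort_uniq enum_uniq. Qed.

Lemma mem_bottom_up v : v \in bottom_up.
Proof. by rewrite mem_sort mem_enum. Qed.

Lemma bottom_up_child (done rest : seq (vertex T)) v c :
  bottom_up = done ++ v :: rest -> edge T v c -> c \in done.
Proof.
move=> E vc; have hvc := tree_height_lt vc.
have := mem_bottom_up c; rewrite E mem_cat inE => /or3P[//|/eqP cv|cr].
  by rewrite cv ltnn in hvc.
have : sorted (relpre (height (edge T)) leq) bottom_up.
  by apply: sort_sorted => x y; apply: leq_total.
rewrite E sorted_pairwise; last by move=> x y z; apply: leq_trans.
rewrite pairwise_cat /= => /and3P[_ _ /andP[/allP/(_ c cr) /= h _]].
by rewrite leqNgt hvc in h.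
Qed.

(** * Correctness of the program *)

Section Correctness.
Variables (n L X : nat) (f : nat -> nat).
Hypothesis L_gt0 : 0 < L.
Hypothesis n_lt : n < 2 ^ L.
Hypothesis f_lt : forall x, x < n -> f x < n.
Hypothesis X_gt1 : 1 < X.
Hypothesis n_le : n <= X.
Hypothesis L_le : L <= X.
Hypothesis pow2_le : forall l, l < L -> 2 ^ l <= X.
Hypothesis tuples_le : forall v, n ^ vsize v <= X.
Hypothesis levels_le : forall v, L ^ size (up_atoms v) <= X.

Let W v t := weight n f v t.
Let Q v t := query n f v t.

Definition cell (parent : bool) v (lam t : nat) : nat :=
  enum_rank v + #|vertex T| * keys n L f parent (up_atoms v) lam t.

Definition insert v (t j a : nat) : nat :=
  \sum_(lam < j) (a == cell false v lam t) * W v t.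

Definition vertex_table v (k a : nat) : nat :=
  \sum_(t < k) insert v t (L ^ size (up_atoms v)) a.

Definition table (done : seq (vertex T)) (a : nat) : nat :=
  \sum_(v <- done) vertex_table v (n ^ vsize v) a.

Hypothesis product_le : forall v t, t < n ^ vsize v ->
  inner_ok n f v t * \prod_(c <- children v) (Q c t).+1 <= X.
Hypothesis query_le : forall v t, Q v t <= X.
Hypothesis table_le : forall a, table bottom_up a <= X.

Definition memory (tab : nat -> nat) (a : nat) : nat :=
  if a < n then f a else if a < n + L then 2 ^ (a - n) else tab (a - (n + L)).

Definition config (t N lam bd acc w : nat) : seq nat :=
  [:: n; L; t; N; lam; bd; acc; w].

Lemma bounded_config (t N lam bd acc w : nat) (tab : nat -> nat) :
  t <= X -> N <= X -> lam <= X -> bd <= X -> acc <= X -> w <= X ->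
  (forall a, tab a <= X) -> bounded X (config t N lam bd acc w) (memory tab).
Proof.
move=> ht hN hlam hbd hacc hw htab.
split=> [|a]; first by rewrite /= n_le L_le ht hN hlam hbd hacc hw.
rewrite /memory; case: ltnP => an; first by rewrite ltnW // (leq_trans (f_lt an)).
by case: ltnP => anL //; apply: pow2_le; lia.
Qed.

Lemma memory_upd (tab : nat -> nat) (a k : nat) :
  upd (memory tab) (n + L + a) k =1 memory (upd tab a k).
Proof.
move=> b; rewrite /upd /memory.
case: (ltnP b n) => bn; first by case: eqP => // ?; lia.
case: (ltnP b (n + L)) => bnL; first by case: eqP => // ?; lia.
congr (if _ then _ else _); lia.
Qed.

Lemma memory_table (tab : nat -> nat) (a : nat) :
  memory tab (n + L + a) = tab a.
Proof.
rewrite /memory [_ < n]ltnNge -addnA leq_addr /= [_ < _ + L]ltnNge addnA leq_addr /=.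
by rewrite addKn.
Qed.

(** * Values of the compiled expressions *)

Section Evaluation.
Variables (t N lam bd acc w : nat) (tab : nat -> nat).
Hypothesis n_gt0 : 0 < n.
Let eval := ev (config t N lam bd acc w) (memory tab).

Lemma ev_digitE (i : nat) : eval (digitE i) = digit n t i.
Proof. by rewrite /eval /digitE ev_modE /= ev_powE. Qed.

Lemma ev_coordE (y : bool) (i : nat) : eval (coordE y i) = coord n f t y i.
Proof.
rewrite /coord; case: y; last exact: ev_digitE.
have -> : eval (coordE true i) = memory tab (eval (digitE i)) by [].
by rewrite ev_digitE /memory digit_lt.
Qed.

Lemma ev_pow2E (l : expr) : eval l < L -> eval (pow2E l) = 2 ^ eval l.
Proof.
rewrite /eval => lL; rewrite [LHS]/= /memory ltnNge leq_addr /= ltn_add2l lL.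
by rewrite addKn.
Qed.

Lemma ev_cross_keyE (parent : bool) (c : cross_atom) (l : expr) :
  eval l < L ->
  eval (cross_keyE parent c l) = cross_key n f parent c (eval l) t.
Proof.
move=> lL; rewrite /cross_keyE /cross_key; set a := coordE _ _.
have Ea : eval a = coord n f t (ca_y c) (if parent then ca_i c else ca_j c).
  exact: ev_coordE.
have El := ev_pow2E lL.
case: eqP => _; rewrite -Ea.
  by rewrite /lower_key -El.
rewrite /upper_keyE /upper_key -El; set q := EOp Div _ _.
have -> : eval (EOp Mul q (modE q (ECst 2))) = eval q * eval (modE q (ECst 2)) by [].
by rewrite /eval ev_modE.
Qed.

Lemma ev_keysE (parent : bool) (cs : seq cross_atom) (e : expr) :
  eval (keysE parent cs e) = keys n L f parent cs (eval e) t.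
Proof.
elim: cs e => [|c cs IH] e //.
have El : eval (modE e (EVar VL)) = eval e %% L by rewrite /eval ev_modE.
have := ev_cross_keyE parent c (l := modE e (EVar VL)).
rewrite El ltn_pmod // => /(_ isT) Ec.
have := IH (EOp Div e (EVar VL)); move: El Ec.
by rewrite /eval /= => -> -> ->.
Qed.

Lemma ev_addrE (parent : bool) v :
  eval (addrE parent v) = n + L + cell parent v lam t.
Proof. by have := ev_keysE parent (up_atoms v) (EVar Vlam); rewrite /eval /= => ->. Qed.

Lemma ev_innerE v : eval (innerE v) = inner_ok n f v t.
Proof.
rewrite /innerE /inner_ok; elim: (inner_atoms v) => //= a s IH.
rewrite -mulnb -IH /eval [LHS]/=; congr muln.
rewrite -[LHS]/(ev _ _ (ltE (coordE a.1.1 a.1.2) (coordE a.1.1 a.2))) ev_ltE.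
by rewrite -/eval !ev_coordE.
Qed.

Lemma ev_boundE v : eval (boundE v) = L ^ size (up_atoms v).
Proof. by rewrite /eval ev_powE. Qed.

Lemma ev_gatherE v : eval (gatherE v) = acc + tab (cell true v lam t).
Proof.
have -> : eval (gatherE v) = acc + memory tab (eval (addrE true v)) by [].
by rewrite ev_addrE memory_table.
Qed.

Lemma ev_addE v : eval (addE v) = tab (cell false v lam t) + w.
Proof.
have -> : eval (addE v) = memory tab (eval (addrE false v)) + w by [].
by rewrite ev_addrE memory_table.
Qed.

End Evaluation.

Lemma runs_set (v v' : seq nat) (m : nat -> nat) (x : var) (e : expr) (k : nat) :
  bounded X v m -> ev v m e = k -> v' = set_nth 0 v (var_reg x) k ->
  runs X v m (assign x e) (acost e) v' m.
Proof. by move=> Hb <- ->; apply: runs_assign. Qed.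

Lemma runs_query v (t N w : nat) (tab : nat -> nat) :
  0 < n -> t <= X -> N <= X -> w <= X -> (forall a, tab a <= X) ->
  \sum_(lam < L ^ size (up_atoms v)) tab (cell true v lam t) = Q v t ->
  w * Q v t <= X ->
  runs X (config t N 0 0 0 w) (memory tab) (query_prog v) (query_time L v)
    (config t N 0 0 0 (w * Q v t)) (memory tab).
Proof.
move=> n_gt0 ht hN hw htab hQ hwQ.
have hK := levels_le v; have hq := query_le v t.
have hacc j : j <= L ^ size (up_atoms v) ->
    \sum_(lam < j) tab (cell true v lam t) <= X.
  move=> jK; apply: leq_trans hq; rewrite -hQ.
  exact: (leq_sum_ord (fun lam => tab (cell true v lam t))).
apply: (runs_seq (v1 := config t N 0 (L ^ size (up_atoms v)) 0 w)).
  by apply: runs_set (ev_boundE _ _ _ _ _ _ _ v) erefl; apply: bounded_config.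
pose acc j := \sum_(lam < j) tab (cell true v lam t).
have -> : config t N 0 (L ^ size (up_atoms v)) 0 w =
          config t N 0 (L ^ size (up_atoms v)) (acc 0) w.
  by rewrite /acc big_ord0.
apply: (runs_seq (v1 := config t N (L ^ size (up_atoms v))
                          (L ^ size (up_atoms v)) (Q v t) w)).
  rewrite -hQ.
  apply: (runs_while X_gt1 (N := L ^ size (up_atoms v))
    (vf := fun j => config t N j (L ^ size (up_atoms v)) (acc j) w)
    (mf := fun=> memory tab)) => [j jK|//|j jK].
    by apply: bounded_config => //; [lia | apply: hacc].
  have hj : acc j <= X by apply: hacc; lia.
  apply: (runs_seq (v1 := config t N j (L ^ size (up_atoms v)) (acc j.+1) w)).
    apply: (runs_set (k := acc j.+1)) => //; first by apply: bounded_config => //; lia.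
    by rewrite ev_gatherE // /acc big_ord_recr.
  apply: (runs_set (k := j.+1)) => //; last by rewrite /= addn1.
  by apply: bounded_config => //; [lia | apply: hacc].
apply: (runs_seq (v1 := config t N (L ^ size (up_atoms v))
                          (L ^ size (up_atoms v)) (Q v t) (w * Q v t))).
  by apply: runs_set erefl erefl; apply: bounded_config.
apply: (runs_seq (v1 := config t N (L ^ size (up_atoms v))
                          (L ^ size (up_atoms v)) 0 (w * Q v t))).
  by apply: runs_set erefl erefl; apply: bounded_config.
apply: (runs_seq (v1 := config t N 0 (L ^ size (up_atoms v)) 0 (w * Q v t))).
  by apply: runs_set erefl erefl; apply: bounded_config.
by apply: runs_set erefl erefl; apply: bounded_config.
Qed.

Lemma eq_memory (tab tab' : nat -> nat) :
  tab =1 tab' -> memory tab =1 memory tab'.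
Proof. by move=> E a; rewrite /memory E. Qed.

Lemma runs_put (v : seq nat) (tab tab' : nat -> nat) (a e : expr) (k x : nat) :
  bounded X v (memory tab) -> ev v (memory tab) a = n + L + k ->
  ev v (memory tab) e = x -> tab' =1 upd tab k x ->
  runs X v (memory tab) (store a e) (scost a e) v (memory tab').
Proof.
move=> Hb Ea Ee Et.
apply: (runs_weaken (runs_store X_gt1 a e Hb)) => // b.
by rewrite Ea Ee memory_upd (eq_memory Et).
Qed.

Lemma insertS v (t j a : nat) :
  insert v t j.+1 a = insert v t j a + (a == cell false v j t) * W v t.
Proof. by rewrite /insert big_ord_recr. Qed.

Lemma runs_insert v (t N : nat) (tab : nat -> nat) :
  0 < n -> t <= X -> N <= X -> W v t <= X ->
  (forall a, tab a + insert v t (L ^ size (up_atoms v)) a <= X) ->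
  runs X (config t N 0 0 0 (W v t)) (memory tab) (insert_prog v) (insert_time L v)
    (config t N 0 0 0 (W v t))
    (memory (fun a => tab a + insert v t (L ^ size (up_atoms v)) a)).
Proof.
move=> n_gt0 ht hN hw htab; have hK := levels_le v.
have htab' j a : j <= L ^ size (up_atoms v) -> tab a + insert v t j a <= X.
  move=> jK; apply: leq_trans (htab a); rewrite leq_add2l.
  exact: (leq_sum_ord (fun lam => (a == cell false v lam t) * W v t)).
have tab0 a : tab a <= X by apply: leq_trans (leq_addr _ _) (htab a).
apply: (runs_seq (v1 := config t N 0 (L ^ size (up_atoms v)) 0 (W v t))
                 (m1 := memory (fun a => tab a + insert v t 0 a))).
  have hb := bounded_config ht hN (leq0n X) (leq0n X) (leq0n X) hw tab0.
  apply: (runs_weaken (runs_set (x := Vbd) hb (ev_boundE _ _ _ _ _ _ _ v) erefl)) => //.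
  by apply: eq_memory => a; rewrite /insert big_ord0 addn0.
apply: (runs_seq (v1 := config t N (L ^ size (up_atoms v))
                          (L ^ size (up_atoms v)) 0 (W v t))).
  apply: (runs_while X_gt1 (N := L ^ size (up_atoms v))
    (vf := fun j => config t N j (L ^ size (up_atoms v)) 0 (W v t))
    (mf := fun j => memory (fun a => tab a + insert v t j a))) => [j jK|//|j jK].
    by apply: bounded_config => //; [lia | move=> a; apply: htab'].
  have jX : j <= X by lia.
  apply: (runs_seq (v1 := config t N j (L ^ size (up_atoms v)) 0 (W v t))
                   (m1 := memory (fun a => tab a + insert v t j.+1 a))).
    apply: runs_put.
    + by apply: bounded_config => // a; apply: htab'; lia.
    + by rewrite ev_addrE.
    + by rewrite ev_addE.
    + move=> a; rewrite /upd insertS; case: eqP => [->|_]; lia.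
  apply: (runs_set (k := j.+1)) => //; last by rewrite /= addn1.
  by apply: bounded_config => // a; apply: htab'.
apply: (runs_seq (v1 := config t N 0 (L ^ size (up_atoms v)) 0 (W v t))).
  by apply: runs_set erefl erefl; apply: bounded_config.
by apply: runs_set erefl erefl; apply: bounded_config.
Qed.

(** * Lookups in the table *)

Lemma eq_cell (c c' : vertex T) (k k' : nat) :
  (enum_rank c + #|vertex T| * k == enum_rank c' + #|vertex T| * k') =
  (c == c') && (k == k').
Proof.
rewrite eq_radix //; congr andb.
by rewrite -[LHS]/(enum_rank c == enum_rank c') (inj_eq enum_rank_inj).
Qed.

Lemma vertex_table_other (c c' : vertex T) (k e : nat) :
  c != c' -> vertex_table c' k (enum_rank c + #|vertex T| * e) = 0.
Proof.
move=> cc'; apply: big1 => t _; apply: big1 => lam _.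
by rewrite eq_cell (negbTE cc').
Qed.

Lemma table_lookup (done : seq (vertex T)) c (e : nat) :
  uniq done -> c \in done ->
  table done (enum_rank c + #|vertex T| * e) =
  \sum_(t < n ^ vsize c) \sum_(lam < L ^ size (up_atoms c))
     (e == keys n L f false (up_atoms c) lam t) * W c t.
Proof.
move=> done_uniq cdone; rewrite /table (bigD1_seq c) //= [X in _ + X]big1 ?addn0.
  apply: eq_bigr => t _; apply: eq_bigr => lam _.
  by rewrite eq_cell eqxx.
by move=> c' cc'; apply: vertex_table_other; rewrite eq_sym.
Qed.

(** The cells of [c] receive nothing from [v], whose tuples are being inserted meanwhile. Exchanging
    the sums over level vectors and tuples leaves the double sum of [sum_keys], the indicator of
    compatibility. *)
Lemma sum_lookup (done : seq (vertex T)) v c (k t : nat) :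
  0 < n -> uniq done -> c \in done -> v \notin done ->
  \sum_(lam < L ^ size (up_atoms c))
     (table done (cell true c lam t) + vertex_table v k (cell true c lam t)) = Q c t.
Proof.
move=> n_gt0 done_uniq cdone vdone.
have cv : c != v by apply: contra vdone => /eqP <-.
under eq_bigr => lam _ do
  rewrite /cell vertex_table_other // addn0 table_lookup //.
rewrite exchange_big /=; apply: eq_bigr => t' _.
under eq_bigr => lam _ do rewrite -big_distrl.
by rewrite -big_distrl /= sum_keys.
Qed.

Lemma weight_children v t :
  W v t = inner_ok n f v t * \prod_(c <- children v) Q c t.
Proof. by rewrite /W weightE /children big_enum. Qed.

(** A partial product may exceed the full one when a later factor is 0; a bound on the product of
    the successors controls every prefix. *)
Lemma prefix_product_le v t (r1 r2 : seq (vertex T)) :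
  t < n ^ vsize v -> children v = r1 ++ r2 ->
  inner_ok n f v t * \prod_(c <- r1) Q c t <= X.
Proof.
move=> tv E; apply: leq_trans (product_le tv); rewrite E big_cat leq_mul2l.
apply/orP; right.
have h r : \prod_(c <- r) Q c t <= \prod_(c <- r) (Q c t).+1.
  by apply: leq_prod.
apply: leq_trans (h r1) _; rewrite leq_pmulr //.
by rewrite prodn_gt0.
Qed.

Lemma vertex_tableS v (t a : nat) :
  vertex_table v t.+1 a = vertex_table v t a + insert v t (L ^ size (up_atoms v)) a.
Proof. by rewrite /vertex_table big_ord_recr. Qed.

Section Vertex.
Variables (done rest : seq (vertex T)) (v : vertex T).
Hypothesis order : bottom_up = done ++ v :: rest.

Let tab (t a : nat) : nat := table done a + vertex_table v t a.

(** The table only grows, so the bound on its final content holds throughout. *)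
Lemma partial_table_le (t a : nat) : t <= n ^ vsize v -> tab t a <= X.
Proof.
move=> tv; apply: leq_trans (table_le a).
rewrite /table order big_cat big_cons leq_add2l; apply: leq_trans (leq_addr _ _).
exact: (leq_sum_ord (fun t => insert v t _ a)).
Qed.

Lemma runs_tuple (t : nat) :
  t < n ^ vsize v ->
  runs X (config t (n ^ vsize v) 0 0 0 0) (memory (tab t)) (tuple_prog v)
    (tuple_time L v) (config t.+1 (n ^ vsize v) 0 0 0 0) (memory (tab t.+1)).
Proof.
move=> tv; have hN := tuples_le v; have tX : t <= X by lia.
have n_gt0 : 0 < n.
  by case: (posnP n) tv => // ->; rewrite exp0n ?vsize_gt0.
have := bottom_up_uniq; rewrite order cat_uniq /= => /and4P[udone ndone _ _].
have vdone : v \notin done by apply: contra ndone => vd; rewrite vd.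
have htab a : tab t a <= X by apply: partial_table_le; lia.
have htab' a : tab t.+1 a <= X by apply: partial_table_le.
pose io : nat := inner_ok n f v t.
pose w r := io * \prod_(c <- r) Q c t.
have wX r1 r2 : children v = r1 ++ r2 -> w r1 <= X by apply: prefix_product_le.
have WE : W v t = w (children v) by apply: weight_children.
have WX : W v t <= X by rewrite WE (wX _ [::]) ?cats0.
apply: (runs_seq (v1 := config t (n ^ vsize v) 0 0 0 (w [::]))).
  apply: (runs_set (k := w [::])) => //; first exact: bounded_config.
  by rewrite ev_innerE // /w big_nil muln1.
apply: (runs_seq (v1 := config t (n ^ vsize v) 0 0 0 (w (children v)))).
  apply: (runs_seqs (vf := fun r => config t (n ^ vsize v) 0 0 0 (w r))
                    (mf := fun=> memory (tab t))) => r1 c r2 E.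
  have wS : w (rcons r1 c) = w r1 * Q c t.
    by rewrite /w -cats1 big_cat big_seq1 /= mulnA.
  rewrite wS; apply: runs_query => //; first exact: wX E.
    apply: sum_lookup => //; apply: (bottom_up_child order).
    have : c \in children v by rewrite E mem_cat inE eqxx orbT.
    by rewrite mem_enum.
  by rewrite -wS; apply: (wX _ r2); rewrite cat_rcons.
rewrite -WE.
apply: (runs_seq (v1 := config t (n ^ vsize v) 0 0 0 (W v t))
                 (m1 := memory (tab t.+1))).
  apply: (runs_weaken (runs_insert n_gt0 tX hN WX (tab := tab t) _)) => //.
    by move=> a; rewrite -addnA -vertex_tableS; apply: htab'.
  by apply: eq_memory => a; rewrite /tab vertex_tableS addnA.
apply: (runs_seq (v1 := config t (n ^ vsize v) 0 0 0 0)).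
  by apply: runs_set erefl erefl; apply: bounded_config.
by apply: (runs_set (k := t.+1)) => //; [apply: bounded_config | rewrite /= addn1].
Qed.

Lemma runs_vertex :
  runs X (config 0 0 0 0 0 0) (memory (table done)) (vertex_prog v)
    (vertex_time n L v) (config 0 0 0 0 0 0) (memory (table (rcons done v))).
Proof.
have hN := tuples_le v.
suff R : runs X (config 0 0 0 0 0 0) (memory (tab 0)) (vertex_prog v)
    (vertex_time n L v) (config 0 0 0 0 0 0) (memory (tab (n ^ vsize v))).
  apply: (runs_weaken R) => //; apply: eq_memory => a.
    by rewrite /tab /vertex_table big_ord0 addn0.
  by rewrite /tab /table -cats1 big_cat big_seq1.
apply: (runs_seq (v1 := config 0 (n ^ vsize v) 0 0 0 0)).
  apply: (runs_set (k := n ^ vsize v)) => //; last by rewrite ev_powE.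
  by apply: bounded_config => // a; apply: partial_table_le.
apply: (runs_seq (v1 := config (n ^ vsize v) (n ^ vsize v) 0 0 0 0)).
  apply: (runs_while X_gt1 (N := n ^ vsize v)
    (vf := fun t => config t (n ^ vsize v) 0 0 0 0)
    (mf := fun t => memory (tab t))) => [t tv|//|t tv]; last exact: runs_tuple.
  by apply: bounded_config => //; [lia | move=> a; apply: partial_table_le].
have htab a : tab (n ^ vsize v) a <= X by apply: partial_table_le.
apply: (runs_seq (v1 := config 0 (n ^ vsize v) 0 0 0 0)).
  by apply: runs_set erefl erefl; apply: bounded_config.
by apply: runs_set erefl erefl; apply: bounded_config.
Qed.

End Vertex.

(** The root has no comparisons upwards, so its only key is 0 and the weights of all its tuples are
    added up in a single cell. *)
Lemma table_root :
  table bottom_up (enum_rank (root T) + #|vertex T| * 0) =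
  \sum_(t < n ^ vsize (root T)) W (root T) t.
Proof.
rewrite table_lookup ?bottom_up_uniq ?mem_bottom_up // up_atoms_root.
by apply: eq_bigr => t _; rewrite big_ord1 mul1n.
Qed.

Lemma runs_vertices :
  exists r, nth 0 r 0 = \sum_(t < n ^ vsize (root T)) W (root T) t /\
  runs X (config 0 0 0 0 0 0) (memory (fun=> 0))
    (Seq (seqs (map vertex_prog bottom_up))
         (assign Vn (EMem (addrE false (root T)))))
    (\sum_(v <- bottom_up) vertex_time n L v + 1 +
     acost (EMem (addrE false (root T))))
    r (memory (table bottom_up)).
Proof.
eexists; split; last first.
  apply: (runs_seq (v1 := config 0 0 0 0 0 0)).
    apply: (runs_weaken (runs_seqs (vf := fun=> config 0 0 0 0 0 0) (mf := fun r => memory (table r)) _)) => //.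
      by move=> r1 v r2 E; apply: runs_vertex E.
    by apply: eq_memory => a; rewrite /table big_nil.
  by apply: runs_set erefl erefl; apply: bounded_config.
rewrite -table_root [LHS]/= /addrE.
by rewrite up_atoms_root /= memory_table.
Qed.

End Correctness.
End Program.

(** * Running time *)

(** The least [L] with [n + 2 <= 2 ^ L]: positive even for [n = 0], and the number of rounds of the
    loop of [init_prog], which runs while [2 ^ l < n + 2]. *)
Definition levels (n : nat) : nat := up_log 2 (n + 2).

Lemma levels_gt0 (n : nat) : 0 < levels n.
Proof. by rewrite /levels up_log_gt0 addn2. Qed.

Lemma ltn_levels (n l : nat) : (2 ^ l < n + 2) = (l < levels n).
Proof.
apply/idP/idP => h; rewrite ltnNge; apply/negP => h'.
  have := up_logP (n + 2) (isT : 1 < 2); rewrite -/(levels n) leqNgt.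
  by rewrite (leq_ltn_trans _ h) // leq_exp2l.
by have := up_log_min (isT : 1 < 2) h'; rewrite -/(levels n) leqNgt h.
Qed.

Lemma ltn_exp_levels (n : nat) : n < 2 ^ levels n.
Proof.
have := up_logP (n + 2) (isT : 1 < 2); rewrite -/(levels n); lia.
Qed.

Lemma leq_exp_levels (n : nat) : 2 ^ levels n <= 2 * (n + 2).
Proof.
have := levels_gt0 n; case E: (levels n) => [//|l] _.
by rewrite expnS leq_mul2l /= ltnW // ltn_levels E.
Qed.

Lemma levels_le (n : nat) : levels n <= n + 2.
Proof. by apply: up_log_min => //; apply/ltnW/ltn_expl. Qed.

Lemma runs_init (n X : nat) (f : nat -> nat) :
  (forall x, x < n -> f x < n) -> (forall x, n <= x -> f x = 0) ->
  2 * (n + 2) <= X ->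
  runs X [:: n; 0; 0; 0; 0; 0; 0; 0] f init_prog (init_time (levels n))
    (config n (levels n) 0 0 0 0 0 0) (memory n (levels n) f (fun=> 0)).
Proof.
move=> f_lt f_default nX; have X_gt1 : 1 < X by lia.
(* After [j] rounds the first [j] powers are stored. As the input memory is 0 beyond the
   permutation, it agrees with the layout that has no powers and an empty table. *)
pose mf j := memory n j f (fun=> 0).
have mf0 : f =1 mf 0.
  move=> a; rewrite /mf /memory addn0; case: ltnP => // na.
  exact: f_default.
have mfX j a : j <= levels n -> mf j a <= X.
  move=> jn; rewrite /mf /memory; case: ltnP => [/f_lt ?|na]; first lia.
  case: ltnP => // anj.
  apply: leq_trans nX; apply: leq_trans (leq_exp_levels n); rewrite leq_exp2l //.
  lia.
have bnd j t N : t <= X -> N <= X -> j <= levels n ->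
    bounded X [:: n; j; t; N; 0; 0; 0; 0] (mf j).
  move=> tX NX jn; split=> [|a]; last exact: mfX.
  by have := levels_le n; rewrite /= tX NX; lia.
have LX : 2 ^ levels n <= X by apply: leq_trans (leq_exp_levels n) nX.
suff R : runs X [:: n; 0; 0; 0; 0; 0; 0; 0] (mf 0) init_prog (init_time (levels n))
    (config n (levels n) 0 0 0 0 0 0) (mf (levels n)).
  exact: (runs_weaken R).
apply: (runs_seq (v1 := [:: n; 0; 0; n + 2; 0; 0; 0; 0])).
  by apply: runs_set => //; apply: bnd.
apply: (runs_seq (v1 := [:: n; 0; 2 ^ 0; n + 2; 0; 0; 0; 0])).
  by apply: runs_set => //; apply: bnd => //; lia.
apply: (runs_seq (v1 := [:: n; levels n; 2 ^ levels n; n + 2; 0; 0; 0; 0])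
                 (m1 := mf (levels n))).
  apply: (runs_while X_gt1 (vf := fun j => [:: n; j; 2 ^ j; n + 2; 0; 0; 0; 0])
            (mf := mf)) => [j jn|j jn|j jn].
  - by apply: bnd => //; [apply: leq_trans LX; rewrite leq_exp2l | lia].
  - exact: ltn_levels.
  have jX : 2 ^ j.+1 <= X by apply: leq_trans LX; rewrite leq_exp2l.
  have jX' : 2 ^ j <= X by apply: leq_trans jX; rewrite leq_exp2l.
  apply: (runs_seq (v1 := [:: n; j; 2 ^ j; n + 2; 0; 0; 0; 0]) (m1 := mf j.+1)).
    have hb : bounded X [:: n; j; 2 ^ j; n + 2; 0; 0; 0; 0] (mf j) by apply: bnd; lia.
    apply: (runs_weaken (runs_store X_gt1 _ _ hb)) => // a /=.
    rewrite /upd /mf /memory; case: eqP => [->|aj].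
      by rewrite ltnNge leq_addr /= ltn_add2l ltnSn addKn.
    case: ltnP => // na; congr (if _ then _ else _); lia.
  have jn' : levels n >= j.+1 by [].
  have hb t : t <= X -> bounded X [:: n; j; t; n + 2; 0; 0; 0; 0] (mf j.+1).
    move=> tX; split=> [|a]; last exact: mfX.
    by have := levels_le n; rewrite /= tX; lia.
  apply: (runs_seq (v1 := [:: n; j; 2 ^ j.+1; n + 2; 0; 0; 0; 0])).
    by apply: (runs_set X_gt1 (k := 2 ^ j.+1)) => //; [apply: hb | rewrite expnSr].
  apply: (runs_set X_gt1 (k := j.+1)) => //; first exact: hb.
  by rewrite /= addn1.
apply: (runs_seq (v1 := [:: n; levels n; 0; n + 2; 0; 0; 0; 0])).
  by apply: runs_set => //; apply: bnd => //; lia.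
by apply: runs_set => //; apply: bnd => //; lia.
Qed.

(* The time bounds below have nonnegative coefficients, so their values at
   [n = L = 1] serve as constant factors. *)
Lemma affine_le (a p b c y : nat) :
  0 < y -> p <= y -> a + (p * b + 2 + c) <= (a + (1 * b + 2 + c)) * y.
Proof. nia. Qed.

Lemma leq_sum_const (N b : nat) (F : nat -> nat) :
  (forall i, i < N -> F i <= b) -> \sum_(i < N) F i <= N * b.
Proof.
move=> h; rewrite -[N in N * b]card_ord -sum_nat_const.
by apply: leq_sum => i _; apply: h.
Qed.

(** * Polynomial bounds on times and values *)

Section Asymptotics.
Variable T : pattern_tree.
Implicit Types v c : vertex T.

Let s := max_size T.
Let V := #|vertex T|.

Definition max_atoms : nat := \max_(v : vertex T) size (up_atoms v).
Let K := max_atoms.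

Lemma size_up_atoms v : size (up_atoms v) <= K.
Proof. exact: (@leq_bigmax _ (fun v => size (up_atoms v))). Qed.

Section Time.
Variables (n L : nat).
Hypothesis L_gt0 : 0 < L.

Let LK_gt0 : 0 < L ^ K. Proof. by rewrite expn_gt0 L_gt0. Qed.

Let LK_le v : L ^ size (up_atoms v) <= L ^ K.
Proof. by rewrite leq_pexp2l // size_up_atoms. Qed.

Lemma query_time_le v : query_time L v <= query_time 1 v * L ^ K.
Proof. by rewrite /query_time exp1n; apply: affine_le. Qed.

Lemma insert_time_le v : insert_time L v <= insert_time 1 v * L ^ K.
Proof. by rewrite /insert_time exp1n; apply: affine_le. Qed.

Lemma tuple_time_le v : tuple_time L v <= tuple_time 1 v * L ^ K.
Proof.
rewrite /tuple_time.
have h : \sum_(c <- children v) query_time L c <=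
         (\sum_(c <- children v) query_time 1 c) * L ^ K.
  by rewrite big_distrl; apply: leq_sum => c _; apply: query_time_le.
have := insert_time_le v; nia.
Qed.

(** The summand 1 keeps the factor positive when [n = 0], so that it can absorb the additive
    constants. *)
Lemma vertex_time_le v :
  vertex_time n L v <= vertex_time 1 1 v * ((n ^ s + 1) * L ^ K).
Proof.
have ns : n ^ vsize v <= n ^ s + 1.
  case: (posnP n) => [->|n0]; first by rewrite exp0n ?vsize_gt0.
  by apply: leq_trans (leq_addr _ _); rewrite leq_pexp2l // vsize_max.
have := tuple_time_le v; rewrite /vertex_time exp1n.
move: (acost _) (acost _) => b a h.
apply: leq_trans (_ : (a + (1 * (tuple_time L v + 2) + 2 + (b + b))) * (n ^ s + 1) <= _).
  by apply: affine_le => //; rewrite addn1.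
rewrite [(n ^ s + 1) * _]mulnC mulnA leq_mul2r; apply/orP; right.
by rewrite !mul1n; nia.
Qed.

Lemma init_time_le : init_time L <= init_time 1 * L.
Proof.
rewrite /init_time.
move: (scost _ _ + _ + 2) => a; move: (acost _) (acost _) (acost _) => b c d.
nia.
Qed.

Lemma count_time_le :
  count_time T n L <= count_time T 1 1 * ((n ^ s + 1) * L ^ K.+1).
Proof.
have h0 : L <= (n ^ s + 1) * L ^ K.+1.
  rewrite expnS; apply: leq_trans (leq_pmulr L LK_gt0) _.
  by rewrite leq_pmull // addn1.
have h1 : (n ^ s + 1) * L ^ K <= (n ^ s + 1) * L ^ K.+1.
  by rewrite leq_mul2l leq_pexp2l ?orbT.
have h2 : \sum_(v <- bottom_up T) vertex_time n L v <=
    (\sum_(v <- bottom_up T) vertex_time 1 1 v) * ((n ^ s + 1) * L ^ K.+1).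
  rewrite big_distrl; apply: leq_sum => v _; apply: leq_trans (vertex_time_le v) _.
  by rewrite leq_mul2l h1 orbT.
have := init_time_le; rewrite /count_time.
move: h0 h2; move: ((n ^ s + 1) * _) (acost _) => y a.
have : 0 < L by [].
move: (\sum_(v <- _) _) (\sum_(v <- _) _) (init_time L) (init_time 1) => p q x z; nia.
Qed.

End Time.

(** The exponent of [n + 2] in a bound on weights: a vertex has at most [V] children, and each
    contributes a sum of at most [(n + 2) ^ s] weights computed with less fuel. *)
Fixpoint weight_exponent (k : nat) : nat :=
  if k is k'.+1 then V * (s + weight_exponent k') else 0.

Let q := s + weight_exponent V.

Section Bounds.
Variables (n : nat) (f : nat -> nat).
(** This base is at least 2 even for [n = 0], so its powers grow with the exponent, and it also
    bounds [levels n]. *)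
Let Y := n + 2.

Let Y_gt0 : 0 < Y. Proof. by rewrite /Y addn2. Qed.

Lemma tuples_le_exp v : n ^ vsize v <= Y ^ s.
Proof.
apply: leq_trans (_ : Y ^ vsize v <= _); first by rewrite leq_exp2r ?leq_addr // vsize_gt0.
by rewrite leq_pexp2l // vsize_max.
Qed.

Lemma weight_rec_le (k : nat) v t : weight_rec n f k v t <= Y ^ weight_exponent k.
Proof.
elim: k v t => [|k IH] v t //=.
apply: leq_trans (_ : \prod_(c | edge T v c) Y ^ (s + weight_exponent k) <= _).
  rewrite -[X in _ <= X]mul1n leq_mul ?leq_b1 //; apply: leq_prod => c _.
  rewrite expnD; apply: leq_trans (_ : n ^ vsize c * Y ^ weight_exponent k <= _).
    apply: (leq_sum_const (F := fun t' => edge_ok n f c t t' * weight_rec n f k c t')).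
    by move=> i _; rewrite -[X in _ <= X]mul1n leq_mul ?leq_b1.
  by rewrite leq_mul2r tuples_le_exp orbT.
rewrite prod_nat_const -expnM mulnC leq_pexp2l // leq_mul2r max_card orbT //.
Qed.

Lemma query_le_exp v t : query n f v t <= Y ^ q.
Proof.
rewrite /q expnD; apply: leq_trans (_ : n ^ vsize v * Y ^ weight_exponent V <= _).
  apply: (leq_sum_const (F := fun t' => edge_ok n f v t t' * weight n f v t')).
  by move=> i _; rewrite -[X in _ <= X]mul1n leq_mul ?leq_b1 // weight_rec_le.
by rewrite leq_mul2r tuples_le_exp orbT.
Qed.

Lemma product_le_exp v t :
  inner_ok n f v t * \prod_(c <- children v) (query n f c t).+1 <= Y ^ (q.+1 * V).
Proof.
rewrite -[X in _ <= X]mul1n leq_mul ?leq_b1 // /children big_enum /=.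
apply: leq_trans (_ : \prod_(c | edge T v c) Y ^ q.+1 <= _).
  apply: leq_prod => c _; have := query_le_exp c t.
  have : 0 < Y ^ q by rewrite expn_gt0 Y_gt0.
  by rewrite expnS /Y; nia.
by rewrite prod_nat_const -expnM leq_pexp2l // leq_mul2l max_card orbT.
Qed.

(** Each of the [V] vertices makes at most [Y ^ s * Y ^ K] insertions of at most
    [Y ^ weight_exponent V], and [V] is below [2 ^ V], hence below [Y ^ V]. *)
Lemma table_le_exp (L a : nat) :
  L <= Y -> 0 < L ->
  table n L f (bottom_up T) a <= Y ^ (V + s + K + weight_exponent V).
Proof.
move=> LY L_gt0.
have hv v : vertex_table n L f v (n ^ vsize v) a <= Y ^ (s + K + weight_exponent V).
  rewrite -addnA expnD.
  apply: leq_trans (_ : n ^ vsize v * Y ^ (K + weight_exponent V) <= _); last first.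
    by rewrite leq_mul2r tuples_le_exp orbT.
  apply: (leq_sum_const (F := fun t => insert n L f v t _ a)) => t _.
  rewrite expnD.
  apply: leq_trans (_ : L ^ size (up_atoms v) * Y ^ weight_exponent V <= _).
    apply: (leq_sum_const (F := fun lam => (a == cell n L f false v lam t) * _)) => lam _.
    by rewrite -[X in _ <= X]mul1n leq_mul ?leq_b1 // weight_rec_le.
  rewrite leq_mul2r; apply/orP; right.
  apply: leq_trans (_ : L ^ K <= _); first by rewrite leq_pexp2l // size_up_atoms.
  by case: (posnP K) => [->|K0] //; rewrite leq_exp2r.
apply: leq_trans (_ : \sum_(v <- bottom_up T) Y ^ (s + K + weight_exponent V) <= _).
  by apply: leq_sum => v _; apply: hv.
rewrite big_const_seq count_predT iter_addn_0 mulnC.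
have -> : V + s + K + weight_exponent V = V + (s + K + weight_exponent V) by lia.
rewrite [X in _ <= X]expnD leq_mul2r; apply/orP; right.
rewrite size_sort -cardE; apply: ltnW; apply: leq_trans (ltn_expl V (isT : 1 < 2)) _.
by rewrite leq_exp2r ?/Y ?addn2 //; apply/card_gt0P; exists (root T).
Qed.

End Bounds.

(** One exponent that dominates the bounds on all variables and cells. It depends on [T] only, which
    keeps the bit lengths logarithmic in [n]. *)
Definition bound_exponent : nat :=
  2 + V + s + K + q.+1 * V.+1 + weight_exponent V.

Lemma count_prog_correct (n : nat) (pi : 'S_n) :
  outputs_within (count_prog T) (perm_input pi) (count_occ T pi)
    (count_time T n (levels n) * bitlen ((n + 2) ^ bound_exponent)).
Proof.
pose f := perm_fun pi; pose X := (n + 2) ^ bound_exponent.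
have X_ge k : k <= bound_exponent -> (n + 2) ^ k <= X.
  by move=> hk; rewrite leq_pexp2l // addn2.
have nX : 2 * (n + 2) <= X.
  apply: leq_trans (X_ge 2 _); last by rewrite /bound_exponent; lia.
  by rewrite expnS expn1 leq_mul2r leq_addl orbT.
have f_lt x : x < n -> f x < n by apply: perm_fun_lt.
have R1 := runs_init f_lt (@perm_fun_default n pi) nX.
have [||||||||||||r [Er R2]] := @runs_vertices T n (levels n) X f.
- exact: levels_gt0.
- exact: ltn_exp_levels.
- exact: f_lt.
- lia.
- lia.
- by have := levels_le n; lia.
- by move=> l; rewrite -ltn_levels; lia.
- move=> v; apply: leq_trans (tuples_le_exp n v) (X_ge _ _).
  by rewrite /bound_exponent; lia.
- move=> v; apply: leq_trans (X_ge (size (up_atoms v)) _); last first.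
    by have := size_up_atoms v; rewrite /bound_exponent; lia.
  by case: (size _) => // k; rewrite leq_exp2r // levels_le.
- move=> v t _; apply: leq_trans (product_le_exp n f v t) (X_ge _ _).
  by rewrite /bound_exponent; nia.
- move=> v t; apply: leq_trans (query_le_exp n f v t) (X_ge _ _).
  by rewrite /bound_exponent; nia.
- move=> a; apply: leq_trans (table_le_exp f a (levels_le n) (levels_gt0 n)) (X_ge _ _).
  by rewrite /bound_exponent; nia.
have [|s' [t' [E T' [V' _]]]] := runs_seq R1 R2 (s := perm_input pi).
  split=> [x|a //] /=; rewrite /upd.
  by do 8 (case: x => [|x] //).
exists s', t'; split=> //.
by rewrite (V' 0) // Er count_occ_weight.
Qed.

Lemma softO_count_time :
  softO (fun n => count_time T n (levels n) * bitlen ((n + 2) ^ bound_exponent))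
        (fun n => n ^ s).
Proof.
(* With [l] the truncated logarithm of [n >= 2], both [levels n] and [bitlen (n + 2)] are at most
   [l + 2 <= 3 * l]. The levels account for [K.+1] logarithmic factors and the bit length for one
   more. *)
exists (count_time T 1 1 * (2 * 3 ^ K.+1) * (bound_exponent * 3)), K.+2, 2 => n n2.
set l := trunc_log 2 n.
have l0 : 0 < l by rewrite trunc_log_gt0.
have nl : n < 2 ^ l.+1 by apply: trunc_log_ltn.
have hL : levels n <= 3 * l.
  apply: leq_trans (_ : l.+2 <= _); last lia.
  by apply: up_log_min => //; move: nl; rewrite !expnS; lia.
have hb : bitlen ((n + 2) ^ bound_exponent) <= bound_exponent * (3 * l).
  apply: leq_trans (bitlen_exp _ _) _; rewrite ?addn2 //.
  rewrite leq_mul2l; apply/orP; right; apply: leq_trans (_ : l.+2 <= _); last lia.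
  rewrite /bitlen ltnS -ltnS -(@ltn_exp2l 2) //.
  apply: leq_ltn_trans (trunc_logP _ _) _ => //.
  by move: nl; rewrite !expnS; lia.
have hs : n ^ s + 1 <= 2 * n ^ s.
  have : 0 < n ^ s by rewrite expn_gt0; lia.
  lia.
apply: leq_trans (leq_mul (count_time_le n (levels_gt0 n)) hb) _.
apply: leq_trans (_ : count_time T 1 1 * (2 * n ^ s * (3 * l) ^ K.+1) *
                      (bound_exponent * (3 * l)) <= _).
  rewrite leq_mul2r; apply/orP; right; rewrite leq_mul2l; apply/orP; right.
  by apply: leq_mul hs _; rewrite leq_exp2r.
rewrite expnMn (expnS l K.+1); move: (l ^ K.+1) (3 ^ K.+1) (n ^ s) (count_time _ _ _).
move=> *; lia.
Qed.

End Asymptotics.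

Theorem theorem3p6 (T : pattern_tree) :
  computable_in_softO (fun n (pi : 'S_n) => count_occ T pi)
                      (fun n => n ^ max_size T).
Proof.
exists (count_prog T).
exists (fun n => count_time T n (levels n) * bitlen ((n + 2) ^ bound_exponent T)).
by split; [apply: count_prog_correct | apply: softO_count_time].
Qed.
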